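(* An $n$-sequence $\gamma = (\gamma_\alpha)_{\alpha \in \mathbf{Z}_+^n}$ ($\gamma_0 > 0$) is a moment sequence, and has a representing measure in $\mathbf{R}_+^n$, if and only if there exists a positive semi-definite $(n+1)$-sequence $\delta = (\delta_{(\alpha,\beta)})_{(\alpha,\beta) \in \mathbf{Z}_+^n \times \mathbf{Z}_+}$ with the following properties: (1) $\gamma_\alpha = \delta_{(\alpha,0)}$ for all $\alpha \in \mathbf{Z}_+^n$. (2) $\delta_{(\alpha,\beta)} = \delta_{(\alpha,\beta+1)} + \delta_{(\alpha+2e_1,\beta+1)} + \cdots + \delta_{(\alpha+2e_n,\beta+1)}$ for all $\alpha \in \mathbf{Z}_+^n$, $\beta \in \mathbf{Z}_+$. (3) $(\delta_{(\alpha+e_j,\beta)})_{(\alpha,\beta) \in \mathbf{Z}_+^n \times \mathbf{Z}_+}$ is a positive semi-definite $(n+1)$-sequence for all $j = 1, \ldots, n$. The $n$-sequence $\gamma$ has a uniquely determined representing measure in $\mathbf{R}_+^n$ if and only if the $(n+1)$-sequence $\delta$ (satisfying these properties) is unique.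
   Context: $n \ge 1$ is a fixed integer; $\mathbf{Z}_+$ is the set of nonnegative integers; $\mathbf{R}_+ = [0,\infty)$; $t^\alpha = t_1^{\alpha_1}\cdots t_n^{\alpha_n}$; $e_j \in \mathbf{Z}_+^n$ is the multi-index whose coordinates are null except the $j$th, which equals $1$. For $N \ge 1$, $\mathcal{P}_N$ is the algebra of polynomial functions on $\mathbf{R}^N$ with complex coefficients. An $N$-sequence is a family of scalars $\gamma = (\gamma_\alpha)_{\alpha \in \mathbf{Z}_+^N}$; it is positive semi-definite if the associated linear map $L_\gamma : \mathcal{P}_N \to \mathbf{C}$, $L_\gamma(t^\alpha) = \gamma_\alpha$, satisfies $L_\gamma(f\bar f) \ge 0$ for all $f \in \mathcal{P}_N$. An $n$-sequence $\gamma$ is a moment sequence if there is a positive Borel measure $\mu$ on $\mathbf{R}^n$ (a representing measure for $\gamma$) such that $\mathcal{P}_n \subset L^2(\mu)$ and $\gamma_\alpha = \int t^\alpha\, d\mu(t)$ for all $\alpha \in \mathbf{Z}_+^n$. A representing measure in $\mathbf{R}_+^n$ is one whose support is contained in $\mathbf{R}_+^n$. *)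

(* Defs.v *)
From mathcomp Require Import all_boot all_order all_algebra.
(* Notations are excluded: those of mpoly clash with those of all_analysis. *)
From mathcomp Require Import -(notations) mpoly.
From mathcomp Require Import all_classical all_reals all_analysis.
From mathcomp.real_closed Require Import complex.

Set Implicit Arguments.
Unset Strict Implicit.
Unset Printing Implicit Defensive.

Import Order.TTheory GRing.Theory Num.Theory.
Import numFieldNormedType.Exports.

Local Open Scope classical_set_scope.
Local Open Scope ring_scope.
Local Open Scope complex_scope.

Notation multiindex := multinom.

(* (alpha, beta) in Z_+^n x Z_+ = Z_+^(n+1); the added coordinate is last, as
   in mnmwiden. *)
Definition mnm_ext (n : nat) (alpha : multiindex n) (beta : nat) :
    multiindex n.+1 :=
  Multinom [tuple of rcons alpha beta].

(* P_N, as formal polynomials; a complex polynomial function on R^N determines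
   its coefficients. *)
Notation Poly R N := (mpoly.mpoly N R[i]).

Notation sequence_on R N := (multiindex N -> R[i]).

Definition Lmap (R : realType) (N : nat) (gamma : sequence_on R N)
    (f : Poly R N) : R[i] :=
  \sum_(m <- msupp f) mcoeff m f * gamma m.

(* Conjugating the coefficients gives the conjugate of f as a function on R^N,
   since the variables are real. *)
Definition conj_poly (R : realType) (N : nat) (f : Poly R N) : Poly R N :=
  map_mpoly (@conjc R) f.

(* For z : R[i], 0 <= z means that z is real and nonnegative. *)
Definition pos_semidef (R : realType) (N : nat) (gamma : sequence_on R N) :
    Prop :=
  forall f : Poly R N, 0 <= Lmap gamma (f * conj_poly f).

(* R^n with its Borel sigma-algebra *)
Notation borelRn R n := (g_sigma_algebraType (@open 'rV[R]_n)).

Definition borel_measure (R : realType) (n : nat) :=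
  {measure set (borelRn R n) -> \bar R}.

Definition monomial_fun (R : realType) (n : nat) (alpha : multiindex n)
    (t : 'rV[R]_n) : R :=
  \prod_(i < n) t 0 i ^+ alpha i.

Definition poly_fun (R : realType) (n : nat) (f : Poly R n) (t : 'rV[R]_n) :
    R[i] :=
  meval (fun i => (t 0 i)%:C) f.

Definition in_L2 (R : realType) (n : nat) (mu : borel_measure R n)
    (f : borelRn R n -> R[i]) : Prop :=
  [/\ measurable_fun setT (fun t => complex.Re (f t)),
      measurable_fun setT (fun t => complex.Im (f t)) &
      (\int[mu]_t ((Normc.normc (f t) ^+ 2)%:E) < +oo)%E].

Definition representing_measure (R : realType) (n : nat)
    (gamma : sequence_on R n) (mu : borel_measure R n) : Prop :=
  (forall f : Poly R n, in_L2 mu (poly_fun f)) /\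
  (forall alpha : multiindex n,
     gamma alpha = (Rintegral mu setT (monomial_fun alpha))%:C).

Definition moment_sequence (R : realType) (n : nat) (gamma : sequence_on R n) :
    Prop :=
  exists mu : borel_measure R n, representing_measure gamma mu.

Definition measure_support (R : realType) (n : nat) (mu : borel_measure R n) :
    set 'rV[R]_n :=
  [set t | forall U : set 'rV[R]_n, open U -> U t -> (0 < mu U)%E].

Definition orthant (R : realType) (n : nat) : set 'rV[R]_n :=
  [set t | forall i : 'I_n, 0 <= t 0 i].

Definition representing_measure_orthant (R : realType) (n : nat)
    (gamma : sequence_on R n) (mu : borel_measure R n) : Prop :=
  representing_measure gamma mu /\ measure_support mu `<=` @orthant R n.

(* In the last condition m ranges over all (alpha, beta), and
   (alpha + e_j, beta) = (alpha, beta) + (e_j, 0). *)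
Definition dim_extension (R : realType) (n : nat) (gamma : sequence_on R n)
    (delta : sequence_on R n.+1) : Prop :=
  [/\ pos_semidef delta,
      forall alpha : multiindex n, gamma alpha = delta (mnm_ext alpha 0),
      forall (alpha : multiindex n) (beta : nat),
        delta (mnm_ext alpha beta) =
          delta (mnm_ext alpha beta.+1) +
          \sum_(j < n) delta (mnm_ext
            (mnm_add alpha (mnm_muln (mnm1 j) 2)) beta.+1) &
      forall j : 'I_n,
        pos_semidef (fun m : multiindex n.+1 =>
          delta (mnm_add m (mnm_ext (mnm1 j) 0)))].

(* Main.v *)
(** Given the measure, put [delta_(a,b) = \int t^a (1 + |t|^2)^(-b)].
    Conversely, write [h = 1 + |x|^2]; under the functional
    [l] of [delta] the extra variable [y] is an inverse of [h], so [y], [1 - y] and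
    [1/2 +- y x_j] act as sums of squares, and [l] is nonnegative on the Bernstein
    products of [y] and the [1/2 + y x_j]. This solves the moment problem for these
    variables on a cube: the Bernstein weights are discrete measures, their limit
    along an ultrafilter is transported to the line by a space-filling curve, and
    its quantile function gives random variables [X_j] with [E p(X) = l (p(v))].
    As [y h = 1], [l (h (1 - y)^m p)] is [O (1/m)] for [p] a sum of squares, whence
    [E (Y^(-k) p(X)) = l (h^k p(v))] by monotone convergence and [Y > 0] almost
    surely; dividing by [Y] recovers all of [delta] as moments of a measure on R^n.
    Condition (3) tested on [y (1 - 2 y x_j)^m] puts this measure on the orthant.
    The numbers [delta] determine the measure, since the algebra generated by the
    coordinates and [1 / (1 + |t|^2)] contains sequences converging boundedly to
    the indicators of finite intersections of half-spaces [t_j > a]. *)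
From HB Require Import structures.
Require Import Defs.
From mathcomp Require Import all_boot all_order all_algebra.
From mathcomp Require Import -(notations) mpoly.
From mathcomp Require Import all_classical all_reals all_analysis.
From mathcomp Require Import measurable_realfun.
From mathcomp Require Import ring lra.
From mathcomp.real_closed Require Import complex.

Set Implicit Arguments.
Unset Strict Implicit.
Unset Printing Implicit Defensive.

Import Order.TTheory GRing.Theory Num.Theory.
Import numFieldNormedType.Exports.

Local Open Scope classical_set_scope.
Local Open Scope ring_scope.

(** * Functionals positive on sums of squares *)

(** In several variables a functional that is nonnegative on squares need not come from a measure,
    since nonnegative polynomials need not be sums of squares. The inverse [y] of [h] removes this
    obstacle: with [V_j = y x_j] the relation [y h = 1] becomes [y^2 + |V|^2 = y], the sphere of
    radius 1/2 about [(y, V) = (1/2, 0)]. Stereographic projection [V / y] identifies this sphere,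
    without its point [y = 0], with R^n. On the bounded set so obtained, positivity has explicit
    certificates by squares. The price is that mass could sit at [y = 0], the point at infinity, and
    that [x_j = V_j / y] is unbounded near it; the decay of [l (h (1 - y)^m p)] settles both. The
    detour through the line is what produces a measure: the limit functional is only finitely
    additive, but on [0, 1] its values on the intervals form a monotone distribution function, and
    the image of Lebesgue measure under the quantile function is countably additive whatever that
    function is. *)

Section SumsOfSquares.
Variables (R : realType) (A : comAlgType R) (l : {linear A -> R^o}).

(* [sos p]: [p] is a sum of squares modulo the ideal of the [q] such that
   [l (q * r) = 0] for all [r]. *)
Inductive sos : A -> Prop :=
| sos_sqr f : sos (f ^+ 2)
| sos_add p q : sos p -> sos q -> sos (p + q)
| sos_eqv p q : sos p -> (forall r, l (p * r) = l (q * r)) -> sos q.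

Lemma sos0 : sos 0. Proof. by have := sos_sqr 0; rewrite expr0n. Qed.

Lemma sos1 : sos 1. Proof. by rewrite -(expr1n _ 2); exact: sos_sqr. Qed.

Lemma sos_mul p q : sos p -> sos q -> sos (p * q).
Proof.
move=> sp; elim: sp q => [f q sq|p1 p2 _ IH1 _ IH2 q sq|p1 p2 _ IH e q sq].
- elim: sq => [g|q1 q2 _ IH1 _ IH2|q1 q2 _ IH e].
  + by rewrite -exprMn; exact: sos_sqr.
  + by rewrite mulrDr; exact: sos_add.
  + by apply: (sos_eqv IH) => r; rewrite ![f ^+ 2 * _]mulrC -!mulrA e.
- by rewrite mulrDl; apply: sos_add; [exact: IH1|exact: IH2].
- by apply: (sos_eqv (IH _ sq)) => r; rewrite -!mulrA e.
Qed.

Lemma sos_exp p k : sos p -> sos (p ^+ k).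
Proof.
move=> sp; elim: k => [|k IH]; first by rewrite expr0; exact: sos1.
by rewrite exprS; exact: sos_mul.
Qed.

Lemma sos_prod (I : Type) (r : seq I) (P : pred I) (F : I -> A) :
  (forall i, P i -> sos (F i)) -> sos (\prod_(i <- r | P i) F i).
Proof. by move=> h; elim/big_ind : _ => //; [exact: sos1|exact: sos_mul]. Qed.

Lemma sos_sum (I : Type) (r : seq I) (P : pred I) (F : I -> A) :
  (forall i, P i -> sos (F i)) -> sos (\sum_(i <- r | P i) F i).
Proof. by move=> h; elim/big_ind : _ => //; [exact: sos0|exact: sos_add]. Qed.

Lemma sosZ (c : R) p : 0 <= c -> sos p -> sos (c *: p).
Proof.
move=> c0 sp; rewrite -[c *: p]mul1r -scalerAr scalerAl; apply: sos_mul => //.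
rewrite -(sqr_sqrtr c0).
have -> : Num.sqrt c ^+ 2 *: 1 = (Num.sqrt c *: 1) ^+ 2 :> A by rewrite exprZn expr1n.
exact: sos_sqr.
Qed.

Hypothesis l_sqr : forall p, 0 <= l (p ^+ 2).

Lemma sos_ge0 p : sos p -> 0 <= l p.
Proof.
move=> sp; have : forall q, 0 <= l (p * q ^+ 2).
  elim: sp => [f q|p1 p2 _ IH1 _ IH2 q|p1 p2 _ IH e q].
  - by rewrite -exprMn.
  - by rewrite mulrDl linearD addr_ge0.
  - by rewrite -e.
by move=> /(_ 1); rewrite expr1n mulr1.
Qed.

Variables (n : nat) (x : 'I_n -> A) (y : A).
Let h := 1 + \sum_j x j ^+ 2.
Hypothesis l_yh : forall p, l (y * h * p) = l p.

Lemma sos_h : sos h.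
Proof.
by apply: sos_add; [exact: sos1|apply: sos_sum => j _; exact: sos_sqr].
Qed.

(** Since [y * h] acts as [1], [y] acts as [y ^+ 2 * h]. *)
Lemma sos_y : sos y.
Proof.
apply: (@sos_eqv (y ^+ 2 * h)); first exact: sos_mul (sos_sqr _) sos_h.
by move=> r; rewrite -(l_yh (y * r)); congr (l _); ring.
Qed.

(** Replacing [1] by [y * h] leaves [y * (h - 1)]. *)
Lemma sos_1By : sos (1 - y).
Proof.
apply: (@sos_eqv (y * \sum_j x j ^+ 2)).
  by apply: sos_mul; [exact: sos_y|apply: sos_sum => j _; exact: sos_sqr].
move=> r; rewrite mulrBl mul1r linearB -[X in _ = X - _]l_yh -linearB.
by congr (l _); rewrite /h; ring.
Qed.

(** Completing the square: the element acts as [y * (h / 2 +- x j)], and [h +- 2 * x j] is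
    [(1 +- x j) ^+ 2] plus the other squares. *)
Lemma sos_half_addyx (j : 'I_n) (b : bool) : sos (2^-1 *: 1 + (-1) ^+ b *: (y * x j)).
Proof.
apply: (@sos_eqv (y * (2^-1 *: ((1 + (-1) ^+ b *: x j) ^+ 2 +
                               \sum_(i | i != j) x i ^+ 2)))).
  apply: sos_mul; first exact: sos_y.
  apply: sosZ; first by rewrite invr_ge0.
  by apply: sos_add; [exact: sos_sqr|apply: sos_sum => i _; exact: sos_sqr].
move=> r.
transitivity (l (y * h * (2^-1 *: r)) + l ((-1) ^+ b *: (y * x j) * r)); last first.
  by rewrite l_yh -linearD mulrDl -[_ *: 1 * r]scalerAl mul1r.
rewrite -linearD; congr (l _).
have -> : h = 1 + (x j ^+ 2 + \sum_(i | i != j) x i ^+ 2) by rewrite /h (bigD1 j).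
rewrite -[2^-1 *: (_ + _)]mulr_algl -[2^-1 *: r]mulr_algl.
rewrite -[_ ^+ b *: x j]mulr_algl -[_ ^+ b *: (_ * _)]mulr_algl.
have : (2^-1%:A + 2^-1%:A : A) = 1.
  by rewrite -scalerDl -mulr2n -[_ *+ 2]mulr_natr mulVf // scale1r.
have : ((-1) ^+ b)%:A ^+ 2 = 1 :> A by rewrite exprZn expr1n sqrr_sign scale1r.
(* With the scalars generalized to [a] and [s], the identity holds only modulo [a + a = 1] and
   [s ^+ 2 = 1]; the last two summands below are multiples of these relations. *)
move: (_%:A) (_%:A) (x j) (\sum_(i | _) _) => a s u S s2 a2.
rewrite [LHS](_ : _ = y * (1 + (u ^+ 2 + S)) * (a * r) + s * (y * u) * r +
  y * u * r * s * (a + a - 1) + (s ^+ 2 - 1) * (y * a * u ^+ 2 * r)); last by ring.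
by rewrite s2 a2 subrr mulr0 mul0r !addr0.
Qed.

Let z := 1 - y.

Lemma sos_1Bexp m : sos (1 - z ^+ m).
Proof.
rewrite -[1 - _]opprB subrX1 -mulNr.
have -> : - (z - 1) = y by rewrite /z; ring.
apply: sos_mul; first exact: sos_y.
by apply: sos_sum => i _; apply: sos_exp; exact: sos_1By.
Qed.

(** Algebraic form of [t * (1 - t) ^+ m <= 1 / (m + 1)] on [0, 1]. The next element is a
    combination, with weights [z] and [y], of the present one and of [1 - z ^+ m.+1]. *)
Lemma sos_1Byexp m : sos (1 - (y * z ^+ m) *+ m.+1).
Proof.
elim: m => [|m IH]; first by rewrite expr0 mulr1; exact: sos_1By.
have -> : 1 - (y * z ^+ m.+1) *+ m.+2 =
    z * (1 - (y * z ^+ m) *+ m.+1) + y * (1 - z ^+ m.+1).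
  rewrite exprS mulrSr mulrBr mulr1 [y * (z * _)]mulrCA -[z * _ *+ m.+1]mulrnAr.
  by move: (_ *+ m.+1) => K; rewrite /z; ring.
apply: sos_add; apply: sos_mul => //; last exact: sos_1Bexp.
- exact: sos_1By.
- exact: sos_y.
Qed.

(* Under [l], [h * z ^+ m] acts as [(y * z ^+ m) * h ^+ 2], and [y * z ^+ m] is
   at most [1 / (m + 1)]. *)
Lemma tail_bound m p : sos p -> 0 <= l (h * z ^+ m * p) <= l (h ^+ 2 * p) / m.+1%:R.
Proof.
move=> sp; apply/andP; split.
  by apply/sos_ge0/sos_mul => //; apply: sos_mul; [exact: sos_h|exact/sos_exp/sos_1By].
rewrite ler_pdivlMr ?ltr0n // -subr_ge0.
have -> : l (h * z ^+ m * p) * m.+1%:R = l ((y * z ^+ m) *+ m.+1 * (h ^+ 2 * p)).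
  rewrite mulr_natr -linearMn mulrnAl !linearMn /=; congr (_ *+ _).
  by rewrite -[LHS]l_yh; congr (l _); ring.
rewrite -linearB -{1}[h ^+ 2 * p]mul1r -mulrBl; apply/sos_ge0/sos_mul => //.
- exact: sos_1Byexp.
- by apply: sos_mul => //; exact: sos_sqr.
Qed.

End SumsOfSquares.

(** * Quantile functions *)

(** Each difference of indicators is the indicator of a cell [b k < s <= b k.+1], and exactly one
    cell contains [s]. It serves both for a grid and for the values of a distribution function on
    that grid. *)
Lemma sum_step (R : realType) (b v : nat -> R) (m : nat) (s : R) :
  nondecreasing_seq b -> b 0%N < s <= b m ->
  exists2 i, (i < m)%N & b i < s <= b i.+1 /\
    \sum_(k < m) v k * ((s <= b k.+1)%R%:R - (s <= b k)%R%:R) = v i.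
Proof.
move=> bnd; elim: m => [/andP[/lt_le_trans /[apply]]|m IH]; first by rewrite ltxx.
move=> /andP[b0 sb]; have [sbm|bms] := leP s (b m).
  have [|i im [bi e]] := IH; first by rewrite b0.
  exists i; first exact: ltnW.
  by split => //; rewrite big_ord_recr /= e sbm sb subrr mulr0 addr0.
exists m => //; split; first by rewrite bms.
rewrite big_ord_recr /= sb leNgt bms /= subr0 mulr1 big1 ?add0r // => k _.
have h i : (i <= m)%N -> (s <= b i) = false.
  by move=> im; apply/negbTE; rewrite -ltNge (le_lt_trans _ bms) // bnd.
by rewrite !h ?subrr ?mulr0 // ltnW.
Qed.

Lemma bounded_integrable (R : realType) d (T : measurableType d)
    (mu : {measure set T -> \bar R}) (D : set T) (f : T -> R) (B : R) :
  measurable D -> (mu D < +oo)%E -> measurable_fun D f ->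
  (forall t, D t -> `|f t| <= B) -> mu.-integrable D (EFin \o f).
Proof.
move=> mD muD mf fB; apply: measurable_bounded_integrable => //.
by exists B; split; [exact: num_real|move=> M BM t Dt /=; rewrite (le_trans (fB t Dt))// ltW].
Qed.

Lemma Rintegral_sum (R : realType) d (T : measurableType d)
    (mu : {measure set T -> \bar R}) (D : set T) (I : Type) (r : seq I) (F : I -> T -> R) :
  measurable D -> (forall i, mu.-integrable D (EFin \o F i)) ->
  mu.-integrable D (EFin \o (fun t => \sum_(i <- r) F i t)) /\
  Rintegral mu D (fun t => \sum_(i <- r) F i t) = \sum_(i <- r) Rintegral mu D (F i).
Proof.
move=> mD iF; elim: r => [|i r [IH1 IH2]].
  rewrite big_nil; split.
    by apply: eq_integrable (integrable0 _ _) => // t _ /=; rewrite big_nil.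
  under eq_Rintegral do rewrite big_nil; by rewrite Rintegral_cst// mul0r.
split.
  apply: (@eq_integrable _ _ _ _ _ mD _ _ _ (integrableD mD (iF i) IH1)) => t _ /=.
  by rewrite big_cons.
under eq_Rintegral do rewrite big_cons; by rewrite RintegralD // IH2 big_cons.
Qed.

Section Quantile.
Variables (R : realType) (E : (R -> R) -> R) (W : R).
Notation mu := (@lebesgue_measure R).

(** Measurability is not asked for: [E] will be a limit of finite weighted sums of values, which
    makes sense for every such function. *)
Definition bounded01 (f : R -> R) := exists B, forall t, 0 <= t <= 1 -> `|f t| <= B.

Hypothesis E_lin : forall a f g, bounded01 f -> bounded01 g ->
  E (fun t => a * f t + g t) = a * E f + E g.
Hypothesis E_mono : forall f g, bounded01 f -> bounded01 g ->
  (forall t, 0 <= t <= 1 -> f t <= g t) -> E f <= E g.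
Hypothesis E1 : E (fun=> 1) = W.

Let cst_bd c : bounded01 (fun=> c).
Proof. by exists `|c|. Qed.

Let lin_bd a f g : bounded01 f -> bounded01 g -> bounded01 (fun t => a * f t + g t).
Proof.
move=> [B hB] [C hC]; exists (`|a| * B + C) => t t01.
by rewrite (le_trans (ler_normD _ _))// normrM lerD ?hC// ler_wpM2l ?hB.
Qed.

Let E0 : E (fun=> 0) = 0.
Proof.
have := @E_lin 1 _ _ (cst_bd 0) (cst_bd 0).
under [X in E X]funext do rewrite mulr0 addr0.
by rewrite mul1r => /eqP; rewrite -subr_eq0 opprD addNKr oppr_eq0 => /eqP.
Qed.

Let E_cst c : E (fun=> c) = c * W.
Proof.
have := @E_lin c _ _ (cst_bd 1) (cst_bd 0); by rewrite E0 E1 !addr0 mulr1.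
Qed.

Let W_ge0 : 0 <= W.
Proof. by rewrite -E0 -E1; apply: E_mono => // t _; exact: ler01. Qed.

Let E_sum (I : Type) (r : seq I) (F : I -> R -> R) (a : I -> R) : (forall i, bounded01 (F i)) ->
  bounded01 (fun t => \sum_(i <- r) a i * F i t) /\
  E (fun t => \sum_(i <- r) a i * F i t) = \sum_(i <- r) a i * E (F i).
Proof.
move=> bF; elim: r => [|i r [IH1 IH2]].
  by rewrite big_nil; under [X in bounded01 X]funext do rewrite big_nil;
    under [X in E X]funext do rewrite big_nil.
under [X in bounded01 X]funext do rewrite big_cons.
under [X in E X]funext do rewrite big_cons.
by split; [exact: lin_bd|rewrite E_lin// IH2 big_cons].
Qed.

Let E_close f g e : bounded01 f -> bounded01 g ->
  (forall t, 0 <= t <= 1 -> `|f t - g t| <= e) -> `|E f - E g| <= e * W.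
Proof.
move=> bf bg fg.
have h u v : bounded01 u -> bounded01 v ->
    (forall t, 0 <= t <= 1 -> `|u t - v t| <= e) -> E u <= E v + e * W.
  move=> bu bv uv; rewrite -E_cst addrC -[E v]mul1r -[E (fun=> e)]mul1r.
  rewrite mul1r addrC -E_lin//; apply: E_mono => //; first exact: lin_bd.
  by move=> t /uv; rewrite mul1r ler_norml lerBlDl => /andP[].
rewrite ler_norml; apply/andP; split.
  by rewrite lerBrDl lerBlDr h// => t t01; rewrite distrC fg.
by rewrite lerBlDl h.
Qed.

Let step (x t : R) : R := (t <= x)%R%:R.

Let step_bd x : bounded01 (step x).
Proof. by exists 1 => t _; rewrite /step; case: (t <= x); rewrite ?normr0 ?normr1. Qed.

Let G x := E (step x).

Let G_nd : {homo G : x y / x <= y}.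
Proof.
move=> x y xy; apply: E_mono => // t _; rewrite /step ler_nat.
by case: (leP t x) => // tx; rewrite (le_trans tx xy).
Qed.

Let G_lt0 x : x < 0 -> G x = 0.
Proof.
move=> x0; rewrite -[RHS]E0; apply/eqP; rewrite eq_le.
by apply/andP; split; apply: E_mono => // t /andP[t0 _]; rewrite /step [t <= x]leNgt (lt_le_trans x0 t0).
Qed.

Let G_ge1 x : 1 <= x -> G x = W.
Proof.
move=> x1; rewrite -[RHS]E1; apply/eqP; rewrite eq_le.
by apply/andP; split; apply: E_mono => // t /andP[_ t1];
  rewrite /step (le_trans t1 x1).
Qed.

(** The alternative [x = 1] keeps the set nonempty for [s] above [W], so that [Q] maps all of R into
    [0, 1]. *)
Let S s := [set x : R | 0 <= x <= 1 /\ (s <= G x \/ x = 1)].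
Let Q s := inf (S s).

Let S1 s : S s 1.
Proof. by rewrite /S/= ler01 lexx; split => //; right. Qed.

Let S_lb s : has_lbound (S s).
Proof. by exists 0 => x [/andP[]]. Qed.

Let Q01 s : 0 <= Q s <= 1.
Proof.
apply/andP; split; last exact: ge_inf.
by apply: lb_le_inf; [exists 1|move=> x [/andP[]]].
Qed.

Let Q_nd : {homo Q : s t / s <= t}.
Proof.
move=> s t st; apply: lb_le_inf; first by exists 1.
move=> x [x01 h]; apply: ge_inf => //; split => //.
by case: h => [h|]; [left; exact: le_trans h|right].
Qed.

Let Q_le s x : 0 <= x <= 1 -> s <= G x -> Q s <= x.
Proof. by move=> x01 sx; apply: ge_inf => //; split => //; left. Qed.

Let Q_ge s x : x <= 1 -> G x < s -> x <= Q s.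
Proof.
move=> x1 xs; apply: lb_le_inf; first by exists 1.
move=> z [_ [sz|->//]]; rewrite leNgt; apply/negP => zx.
by have := lt_le_trans xs (le_trans sz (G_nd (ltW zx))); rewrite ltxx.
Qed.

Let D : set (measurableTypeR R) := [set` `]0, W]].

Let mD : measurable D. Proof. exact: measurable_itv. Qed.

Let P : {measure set (measurableTypeR R) -> \bar R} := mrestr mu mD.

Let PD : P D = W%:E.
Proof.
rewrite /P/= /mrestr setIid lebesgue_measure_itv/= lte_fin.
by case: ltgtP W_ge0 => // [W0 _|<-//]; rewrite oppr0 adde0.
Qed.

Let PT : P setT = W%:E.
Proof. by rewrite -PD /P/= /mrestr setTI setIid. Qed.

Let PDC : P (~` D) = 0.
Proof. by rewrite /P/= /mrestr setICl measure0. Qed.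

Let P_step a : 0 <= a <= W -> Rintegral P D (fun s => (s <= a)%R%:R) = a.
Proof.
move=> /andP[a0 aW].
rewrite (@eq_Rintegral _ _ _ P _ (\1_([set` `]-oo, a]] : set (measurableTypeR R)))); last first.
  by move=> s _; rewrite indicE mem_setE in_itv.
rewrite /Rintegral integral_indic//.
have -> : [set` `]-oo, a]] `&` D = [set` `]0, a]].
  apply/seteqP; split => s /=; rewrite /D/= !in_itv/=.
    by move=> [-> /andP[->]].
  by move=> /andP[-> sa]; rewrite sa (le_trans sa aW).
rewrite /P/= /mrestr.
have -> : [set` `]0, a]] `&` D = [set` `]0, a]].
  apply/setIidPl => s /=; rewrite /D/= !in_itv/=.
  by move=> /andP[-> sa]; rewrite (le_trans sa aW).
rewrite lebesgue_measure_itv/= lte_fin.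
by case: ltgtP a0 => // a0 _; rewrite oppr0 adde0.
Qed.

Let measurable_Q : measurable_fun setT (Q : measurableTypeR R -> R).
Proof. exact: nondecreasing_measurable. Qed.

(* [Q] is the quantile function of [E]: on a cell between two consecutive grid
   points, [E] and the image of Lebesgue measure under [Q] have the same mass. No
   continuity of [G] is needed for this. *)
Lemma quantile_representation :
  exists d (S : measurableType d) (P : {measure set S -> \bar R}) (Q : S -> R),
  [/\ P setT = W%:E, measurable_fun setT Q, forall s, 0 <= Q s <= 1 &
    forall g : R -> R, measurable_fun setT g -> bounded01 g ->
     (forall e : R, 0 < e -> exists2 d : R, 0 < d &
        forall t u : R, 0 <= t <= 1 -> 0 <= u <= 1 ->
        `|t - u| <= d -> `|g t - g u| <= e) ->
     Rintegral P setT (g \o Q) = E g].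
Proof.
exists _, (measurableTypeR R), P, Q; split => // g mg bg ucg.
have PT_fin : (P setT < +oo)%E by rewrite PT ltry.
have PD_fin : (P D < +oo)%E by rewrite PD ltry.
have [B hB] := bg.
have mgQ : measurable_fun setT (g \o Q : measurableTypeR R -> R).
  exact: measurableT_comp.
have igQT : P.-integrable setT (EFin \o (g \o Q : measurableTypeR R -> R)).
  by apply: (@bounded_integrable _ _ _ P setT _ B measurableT) => // t _; exact: hB.
have igQ : P.-integrable D (EFin \o (g \o Q : measurableTypeR R -> R)).
  exact: integrableS igQT.
have -> : Rintegral P setT (g \o Q) = Rintegral P D (g \o Q).
  rewrite /Rintegral (negligible_integral (measurableC mD) _ igQT PDC)//.
  by rewrite setTD setCK.
apply/eqP; rewrite -subr_eq0 -normr_eq0 eq_le normr_ge0 andbT.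
apply/ler_addgt0Pr => e0 e0_gt0; rewrite add0r.
(* Two approximations cost [e * W] each; the [+ 1] covers [W = 0]. *)
pose e : R := e0 / (2 * (W + 1)).
have W1 : 0 < W + 1 by rewrite ltr_wpDl.
have e_gt0 : 0 < e by rewrite divr_gt0// mulr_gt0.
have [d d0 gd] := ucg e e_gt0.
clear ucg.
have [r rd] : exists r : nat, r.+1%:R^-1 <= d.
  exists (Num.truncn d^-1); rewrite invf_ple ?posrE ?ltr0n//.
  exact/ltW/truncnS_gt.
(* The grid starts at a negative point, so that the half-open cells cover 0 as well and
   [G (p 0) = 0] lies below every [s] in []0, W]]. *)
pose p (i : nat) : R := (i%:R - 1) / r.+1%:R.
have p_nd : nondecreasing_seq p.
  by move=> i j ij; rewrite ler_pM2r ?invr_gt0 ?ltr0n// lerD2r ler_nat.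
have pS i : p i.+1 - p i = r.+1%:R^-1.
  rewrite /p -mulrBl; have -> : i.+1%:R - 1 - (i%:R - 1) = 1 :> R by rewrite -natr1; ring.
  by rewrite mul1r.
have p01 (i : nat) : (i < r.+2)%N -> 0 <= p i.+1 <= 1.
  move=> ir; rewrite /p -natr1 addrK divr_ge0 ?ler0n//=.
  by rewrite ler_pdivrMr ?ltr0n// mul1r ler_nat -ltnS.
have p0 : p 0 < 0 by rewrite /p sub0r mulN1r oppr_lt0 invr_gt0 ltr0n.
have pr : p r.+2 = 1 by rewrite /p -natr1 addrK divff// pnatr_eq0.
pose v i := g (p i.+1).
(* [tau] is a step function close to [g]. In [tau'] the cells are cut at the values of [G] instead,
   which makes it close to [g \o Q]. Both have the integral [V]. *)
pose tau t : R := \sum_(i < r.+2) v i * (step (p i.+1) t - step (p i) t).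
pose tau' s : R := \sum_(i < r.+2) v i * ((s <= G (p i.+1))%R%:R - (s <= G (p i))%R%:R).
pose V : R := \sum_(i < r.+2) v i * (G (p i.+1) - G (p i)).
have [btau Etau] : bounded01 tau /\ E tau = V.
  have [|bt Et] := @E_sum _ (index_enum 'I_r.+2)
      (fun i t => step (p i.+1) t - step (p i) t) v.
    move=> i; under [X in bounded01 X]funext do rewrite -mulN1r addrC.
    exact: lin_bd.
  split => //; rewrite /tau Et; apply: eq_bigr => i _; congr (_ * _).
  under [X in E X]funext do rewrite -mulN1r addrC.
  by rewrite E_lin// mulN1r addrC.
have Eg : `|E g - V| <= e * W.
  rewrite -Etau; apply: E_close => // t /andP[t0 t1].
  have [|i ir [/andP[it ti] tauE]] := @sum_step _ p v r.+2 t p_nd.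
    by rewrite pr t1 (lt_le_trans p0).
  rewrite /tau /step tauE; apply: gd; [by rewrite t0| by rewrite p01|].
  rewrite distrC ger0_norm ?subr_ge0//; apply: le_trans rd.
  by rewrite -(pS i) lerD2l lerN2 ltW.
have mstep a : measurable_fun D (fun s : measurableTypeR R => (s <= a)%R%:R : R).
  apply: (@nonincreasing_measurable R) => // s t st; rewrite ler_nat.
  by case: (leP t a) => // ta; rewrite (le_trans st ta).
have istep a : P.-integrable D (EFin \o (fun s : measurableTypeR R => (s <= a)%R%:R : R)).
  apply: (@bounded_integrable _ _ _ P D _ 1 mD PD_fin (mstep a)) => t _.
  by case: (t <= a); rewrite ?normr0 ?normr1.
have G0W x : x <= 1 -> 0 <= G x <= W.
  move=> x1; rewrite -[in X in _ && X](G_ge1 (lexx 1)) G_nd// andbT.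
  by rewrite -E0; apply: E_mono => // t _; rewrite /step ler0n.
have p_le1 (i : nat) : (i <= r.+2)%N -> p i <= 1.
  by move=> ir; rewrite -pr; exact: p_nd.
have istep2 i : P.-integrable D (EFin \o
    (fun s : measurableTypeR R => v i * ((s <= G (p i.+1))%R%:R - (s <= G (p i))%R%:R))).
  have idf := integrableB mD (istep (G (p i.+1))) (istep (G (p i))).
  exact: eq_integrable (integrableZl mD (v i) idf).
have [itau Itau] : P.-integrable D (EFin \o tau') /\ Rintegral P D tau' = V.
  have [it It] := @Rintegral_sum _ _ _ P D _ (index_enum 'I_r.+2)
    (fun i s => v i * ((s <= G (p i.+1))%R%:R - (s <= G (p i))%R%:R)) mD
    (fun i => istep2 i).
  split => //; rewrite /tau' It; apply: eq_bigr => i _.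
  rewrite RintegralZl//; last exact: eq_integrable (integrableB mD (istep _) (istep _)).
  by rewrite RintegralB// !P_step// G0W// p_le1// ltnW.
have Ig : `|Rintegral P D (g \o Q) - V| <= e * W.
  rewrite -Itau -RintegralB//.
  have idiff := integrableB mD igQ itau.
  apply: le_trans (le_normr_Rintegral mD idiff) _.
  have -> : e * W = Rintegral P D (fun=> e) by rewrite Rintegral_cst// PD.
  apply: le_Rintegral => //.
  - exact: (integrable_norm idiff).
  - by apply: (@bounded_integrable _ _ _ P D _ `|e|).
  move=> s; rewrite /D/= in_itv/= => /andP[s0 sW].
  have [||i ir [/andP[it ti] tauE]] := @sum_step _ (G \o p) v r.+2 s.
  - by move=> i j ij; apply: G_nd; exact: p_nd.
  - by rewrite /= pr (G_ge1 (lexx 1)) (G_lt0 p0) s0.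
  rewrite /tau' tauE; apply: gd => //; first by rewrite p01.
  rewrite distrC ger0_norm ?subr_ge0 ?Q_le ?p01//; apply: le_trans rd.
  rewrite -(pS i) lerD2l lerN2; apply: Q_ge => //; apply: p_le1; exact: ltnW.
rewrite (le_trans (ler_distD V _ _))//.
apply: (@le_trans _ _ (e * W + e * W)); first by rewrite lerD// distrC.
rewrite /e -mulrDl.
have -> : e0 / (2 * (W + 1)) + e0 / (2 * (W + 1)) = e0 / (W + 1).
  by field; rewrite gt_eqF.
by rewrite mulrAC ler_pdivrMr// ler_pM2l// lerDl.
Qed.

End Quantile.

(** * A space-filling curve *)

Section Digits.
Variables (R : realType) (z : R).
Hypothesis z01 : 0 < z < 1.

(** The factor [1 - z] normalizes the range to [0, 1]. For [z = 1/2] this is the binary expansion,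
    for [z = 1/3] the ternary expansion with digits [2 * a k]. Fractional [a k] are allowed because
    a continuous curve must pass through them. *)
Definition digits (a : nat -> R) : R := limn (series (fun k => a k * ((1 - z) * z ^+ k))).

Definition unit_seq (a : nat -> R) := forall k, 0 <= a k <= 1.

Let shift (m : nat) (a : nat -> R) k := a (m + k)%N.

Lemma unit_seq_shift m a : unit_seq a -> unit_seq (shift m a).
Proof. by move=> ua k; exact: ua. Qed.

Let g_ge0 k : 0 <= (1 - z) * z ^+ k.
Proof. by case/andP: z01 => z0 z1; rewrite mulr_ge0 ?exprn_ge0 ?subr_ge0 ?ltW. Qed.

Let cvg_g : series (geometric (1 - z) z) @ \oo --> (1 : R).
Proof.
case/andP: z01 => z0 z1.
have := @cvg_geometric_series R (1 - z) z; rewrite gtr0_norm// => /(_ z1).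
by rewrite divff// subr_eq0 gt_eqF.
Qed.

Lemma is_cvg_digits a : unit_seq a -> cvgn (series (fun k => a k * ((1 - z) * z ^+ k))).
Proof.
move=> ua; apply: (@series_le_cvg R _ (geometric (1 - z) z)).
- by move=> k; rewrite mulr_ge0//; case/andP: (ua k).
- by move=> k; exact: g_ge0.
- by move=> k; rewrite /= ler_piMl//; case/andP: (ua k).
- by apply: cvgP; exact: cvg_g.
Qed.

Lemma digits01 a : unit_seq a -> 0 <= digits a <= 1.
Proof.
move=> ua; apply/andP; split.
  apply: limr_ge; first exact: is_cvg_digits.
  apply: nearW => k; rewrite /series/=; apply: sumr_ge0 => i _.
  by rewrite mulr_ge0//; case/andP: (ua i).
rewrite -[leRHS](cvg_lim _ cvg_g)//; apply: lim_series_le.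
- exact: is_cvg_digits.
- by apply: cvgP; exact: cvg_g.
- by move=> k; rewrite /= ler_piMl//; case/andP: (ua k).
Qed.

Lemma digitsS a : unit_seq a -> digits a = (1 - z) * a 0%N + z * digits (shift 1 a).
Proof.
move=> ua; rewrite [LHS]/digits; apply: cvg_lim => //.
rewrite -cvg_shiftS.
have -> : [sequence series (fun k => a k * ((1 - z) * z ^+ k)) n.+1]_n =
    (fun n => (1 - z) * a 0%N + z * series (fun k => shift 1 a k * ((1 - z) * z ^+ k)) n).
  apply/funext => n /=; rewrite /series/= big_nat_recl// expr0 mulr1 mulrC mulr_sumr.
  by congr (_ + _); apply: eq_bigr => i _; rewrite exprS /shift add1n; ring.
apply: cvgD; first exact: cvg_cst.
apply: cvgM; first exact: cvg_cst.
apply: is_cvg_digits; exact: unit_seq_shift.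
Qed.

(** Unrolling [K] terms gives a convex combination of errors at most [e] and of a tail of weight
    [z ^+ K]. *)
Lemma digits_dist a b K e : unit_seq a -> unit_seq b ->
  (forall k, (k < K)%N -> `|a k - b k| <= e) -> 0 <= e ->
  `|digits a - digits b| <= e + z ^+ K.
Proof.
case/andP: z01 => z0 z1.
elim: K a b => [|K IH] a b ua ub ab e0.
  rewrite expr0 (@le_trans _ _ 1)// ?lerDr//.
  have /andP[a0 a1] := digits01 ua; have /andP[b0 b1] := digits01 ub.
  by rewrite ler_norml; apply/andP; split; lra.
rewrite (digitsS ua) (digitsS ub).
have -> : (1 - z) * a 0%N + z * digits (shift 1 a) - ((1 - z) * b 0%N + z * digits (shift 1 b)) =
  (1 - z) * (a 0%N - b 0%N) + z * (digits (shift 1 a) - digits (shift 1 b)) by ring.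
apply: le_trans (ler_normD _ _) _.
rewrite !normrM (gtr0_norm z0) [`|1 - z|]ger0_norm ?subr_ge0 ?(ltW z1)//.
apply: (@le_trans _ _ ((1 - z) * e + z * (e + z ^+ K))).
  apply: lerD; apply: ler_wpM2l; rewrite ?subr_ge0 ?(ltW z0) ?(ltW z1)//; first exact: ab.
  apply: IH => //; try exact: unit_seq_shift.
  by move=> k kK; exact: ab.
by rewrite exprS; lra.
Qed.

(** Each shift contracts the difference of two bounded solutions of the recursion by [z]. *)
Lemma digits_unique a (u : nat -> R) : unit_seq a -> unit_seq u ->
  (forall k, u k = (1 - z) * a k + z * u k.+1) -> digits a = u 0%N.
Proof.
case/andP: z01 => z0 z1 ua uu ur; apply/eqP; rewrite -subr_eq0 -normr_le0.
have h K b v : unit_seq b -> unit_seq v -> (forall k, v k = (1 - z) * b k + z * v k.+1) ->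
    `|digits b - v 0%N| <= z ^+ K.
  elim: K b v => [|K IH] b v ub uv vr.
    rewrite expr0; have /andP[a0 a1] := digits01 ub; have /andP[b0 b1] := uv 0%N.
    by rewrite ler_norml; apply/andP; split; lra.
  rewrite (digitsS ub) vr.
  have -> : (1 - z) * b 0%N + z * digits (shift 1 b) - ((1 - z) * b 0%N + z * v 1%N) =
    z * (digits (shift 1 b) - v 1%N) by ring.
  rewrite normrM (gtr0_norm z0) exprS ler_wpM2l ?(ltW z0)//.
  by apply: (IH (shift 1 b) (shift 1 v)) => [||k]; [exact: unit_seq_shift|exact: unit_seq_shift|exact: vr].
apply: (@cvgr_to_ge _ \oo _ _ (fun K => z ^+ K)).
- by apply: cvg_expr; rewrite gtr0_norm.
- by apply: nearW => K; exact: h.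
Qed.

End Digits.

Section CubeCurve.
Variable R : realType.

(** The values of [cos (pi * t)] at 1/3 and 2/3 are [c] and [- c]; dividing by [2 * c] in [wave]
    sends them to 0 and 1. Only [0 < c] is used about the number itself. *)
Let c : R := cos (pi / 3).

Let c_gt0 : 0 < c.
Proof.
have p0 := pi_gt0 R.
rewrite /c -cos_pihalf ltr_cos ?in_itv/=; lra.
Qed.

(* The clamping creates plateaus on [0, 1/3] and [2/3, 1], where the leading
   ternary digit is 0 and 2 respectively; the period is 2. *)
Definition wave (t : R) : R := Num.max 0 (Num.min 1 (2^-1 - cos (pi * t) / (2 * c))).

Lemma wave01 t : 0 <= wave t <= 1.
Proof. by rewrite /wave le_max lexx ge_max ler01 ge_min lexx. Qed.

Lemma wave_period t (k : nat) : wave (t + k.*2%:R) = wave t.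
Proof.
rewrite /wave mulrDr; congr (Num.max _ (Num.min _ (_ - _ / _))).
have -> : pi * k.*2%:R = (pi *+ 2) *+ k :> R by rewrite -mulrnA mul2n mulr_natr.
by rewrite (periodicn (@cosD2pi R)).
Qed.

Lemma wave0 t : 0 <= t <= 3^-1 -> wave t = 0.
Proof.
move=> /andP[t0 t3]; have p0 := pi_gt0 R.
have h : c <= cos (pi * t).
  rewrite leNgt ltr_cos ?in_itv/= -?leNgt ?ler_pM2l//.
  - lra.
  - by apply/andP; split; [rewrite mulr_ge0// ltW|rewrite ler_piMr ?(ltW p0)//; lra].
rewrite /wave; apply/max_idPl; rewrite ge_min; apply/orP; right.
by rewrite subr_le0 ler_pdivlMr ?mulr_gt0// mulKf.
Qed.

Lemma wave1 t : 2 / 3 <= t <= 1 -> wave t = 1.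
Proof.
move=> /andP[t0 t3]; have p0 := pi_gt0 R.
have h : cos (pi * t) <= - c.
  rewrite /c -[X in - cos X]opprK cosN -cosDpi leNgt ltr_cos ?in_itv/= -?leNgt.
- have h : pi * (2 / 3) <= pi * t by rewrite ler_pM2l.
    lra.
  - by apply/andP; split; [rewrite mulr_ge0 ?(ltW p0)//; lra|rewrite ler_piMr ?(ltW p0)//; lra].
  - lra.
rewrite /wave; have -> : Num.min 1 (2^-1 - cos (pi * t) / (2 * c)) = 1.
  apply/min_idPl; rewrite lerBrDr -lerBrDl ler_pdivrMr ?mulr_gt0//.
  apply: le_trans h _; lra.
by apply/max_idPr.
Qed.

Lemma cos_lipschitz (x y : R) : `|cos x - cos y| <= `|x - y|.
Proof.
wlog xy : x y / x <= y.
  by move=> h; case: (leP x y) => [/h//|/ltW /h]; rewrite distrC (distrC y).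
rewrite distrC (distrC x).
have [|z _ ->] := @MVT_segment _ cos (- sin) _ _ xy.
  exact/continuous_subspaceT/continuous_cos.
by rewrite normrM ler_piMl// normrN sin_max.
Qed.

Lemma wave_lipschitz (x y : R) : `|wave x - wave y| <= pi / (2 * c) * `|x - y|.
Proof.
have p0 := pi_gt0 R.
have nonexp (f : R -> R) : (forall u v, u <= v -> f u <= f v <= f u + (v - u)) ->
    forall u v, `|f u - f v| <= `|u - v|.
  move=> hf u v; wlog uv : u v / u <= v.
    by move=> h; case: (leP u v) => [/h//|/ltW /h]; rewrite distrC (distrC v).
  have /andP[h1 h2] := hf u v uv; rewrite distrC (distrC u) !ger0_norm ?subr_ge0//.
  by rewrite lerBlDl.
have clamp (u v : R) : `|Num.max 0 (Num.min 1 u) - Num.max 0 (Num.min 1 v)| <= `|u - v|.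
  apply: (@le_trans _ _ `|Num.min 1 u - Num.min 1 v|); apply: nonexp => {}u {}v uv.
  - by case: (leP 0 u); case: (leP 0 v) => ? ?; apply/andP; split; lra.
  - by case: (leP 1 u); case: (leP 1 v) => ? ?; apply/andP; split; lra.
apply: le_trans (clamp _ _) _.
have -> : 2^-1 - cos (pi * x) / (2 * c) - (2^-1 - cos (pi * y) / (2 * c)) =
  (cos (pi * y) - cos (pi * x)) / (2 * c) by ring.
rewrite normrM mulrAC [`|_^-1|]gtr0_norm ?invr_gt0 ?mulr_gt0//.
rewrite ler_pM2r ?invr_gt0 ?mulr_gt0//.
apply: le_trans (cos_lipschitz _ _) _.
by rewrite -mulrBr normrM (gtr0_norm p0) distrC.
Qed.

(** Remainders of the greedy binary expansion. They stay in [0, 1], and 1 is a fixed point, with all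
    digits 1. *)
Definition binary_tail (v : R) (k : nat) : R :=
  iter k (fun v => 2 * v - (2^-1 <= v)%R%:R) v.

Definition bit (v : R) (k : nat) : bool := 2^-1 <= binary_tail v k.

Let half01 : 0 < (2^-1 : R) < 1. Proof. by apply/andP; split; lra. Qed.

Let third01 : 0 < (3^-1 : R) < 1. Proof. by apply/andP; split; lra. Qed.

Lemma unit_seq_bool (b : nat -> bool) : unit_seq (fun k => (b k)%:R : R).
Proof. by move=> k; case: (b k); rewrite lexx ler01. Qed.

Lemma digits_bit v : 0 <= v <= 1 -> digits 2^-1 (fun k => (bit v k)%:R) = v.
Proof.
move=> v01; apply: (@digits_unique _ _ half01 _ (binary_tail v)).
- exact: unit_seq_bool.
- elim=> [//|k]; rewrite /binary_tail iterS -/(binary_tail v k).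
  by case: (leP 2^-1 (binary_tail v k)) => h /andP[h0 h1]; rewrite ?mulr1n ?mulr0n; apply/andP; split; lra.
- move=> k; rewrite /bit [binary_tail v k.+1]/binary_tail iterS -/(binary_tail v k).
  by set b := _%:R; field.
Qed.

(** The ternary digits are 0 and 2, so the part split off by a power of 3 is an even integer,
    invisible to a function of period 2. *)
Lemma digits3_expr (a : nat -> bool) m : exists N : nat,
  3 ^+ m * digits 3^-1 (fun k => (a k)%:R : R) =
  N.*2%:R + digits 3^-1 (fun k => (a (m + k)%N)%:R).
Proof.
elim: m => [|m [N IH]]; first by exists 0%N; rewrite expr0 mul1r add0r.
exists (3 * N + a m)%N; rewrite exprS -mulrA IH.
rewrite (@digitsS _ _ third01) ?addn0; last exact: (unit_seq_bool (fun k => a (m + k)%N)).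
have -> : (fun k => (a (m + (1 + k))%N)%:R : R) = (fun k => (a (m.+1 + k)%N)%:R).
  by apply/funext => k; rewrite addnA addn1.
move: (digits _ _) => T; rewrite -!muln2 !natrM natrD natrM; lra.
Qed.

(** Modulo the period the argument lies in [0, 1/3] or in [2/3, 1] according to the digit [a m],
    hence on a plateau of [wave]. *)
Lemma wave_digits (a : nat -> bool) m :
  wave (3 ^+ m * digits 3^-1 (fun k => (a k)%:R : R)) = (a m)%:R.
Proof.
have [N ->] := digits3_expr a m; rewrite addrC wave_period.
rewrite (@digitsS _ _ third01) ?addn0; last exact: (unit_seq_bool (fun k => a (m + k)%N)).
have /andP[T0 T1] := @digits01 _ _ third01 _ (unit_seq_bool (fun k => a (m + (1 + k))%N)).
by case: (a m); rewrite ?mulr1n ?mulr0n; [apply: wave1|apply: wave0];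
  apply/andP; split; lra.
Qed.

(* Schoenberg's curve: the ternary digits of [t] are dealt out cyclically to the
   coordinates, as their binary digits. *)
Lemma cube_curve (M : nat) : exists D : 'I_M.+1 -> R -> R,
  [/\ forall j t, 0 <= D j t <= 1,
      forall j (e : R), 0 < e -> exists2 d : R, 0 < d &
        forall t u, `|t - u| <= d -> `|D j t - D j u| <= e &
      forall x : 'I_M.+1 -> R, (forall j, 0 <= x j <= 1) ->
        exists2 t, 0 <= t <= 1 & forall j, D j t = x j].
Proof.
pose w (j : 'I_M.+1) t k := wave (3 ^+ (k * M.+1 + j) * t).
have uw j t : unit_seq (w j t) by move=> k; exact: wave01.
exists (fun j t => digits 2^-1 (w j t)); split.
- by move=> j t; exact: digits01.
- move=> j e e0.
  have [K hK] : exists K : nat, (2^-1 : R) ^+ K <= e / 2.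
    have h2 : (fun K => (2^-1 : R) ^+ K) @ \oo --> (0 : R).
      by apply: cvg_expr; rewrite gtr0_norm//; case/andP: half01.
    have /cvgrPdist_le/(_ (e / 2)) := h2.
    rewrite divr_gt0// => /(_ isT) [K _ hK]; exists K.
    by have := hK K (leqnn _); rewrite /= sub0r normrN ger0_norm// exprn_ge0// ltW// invr_gt0.
  (* A common Lipschitz constant for the terms [k < K], whose frequencies are at most this power of
     3; the other terms contribute at most [2^-1 ^+ K]. *)
  pose L : R := pi / (2 * c) * 3 ^+ (K * M.+1 + M.+1).
  have pc0 : 0 < pi / (2 * c) by rewrite divr_gt0 ?pi_gt0// mulr_gt0.
  have L0 : 0 < L by rewrite mulr_gt0// exprn_gt0.
  exists (e / 2 / L); first by rewrite !divr_gt0.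
  move=> t u tu; rewrite (splitr e); apply: le_trans (_ : e / 2 + 2^-1 ^+ K <= _); last first.
    by rewrite lerD2l.
  apply: digits_dist => //; last by rewrite divr_ge0// ltW.
  move=> k kK; apply: le_trans (wave_lipschitz _ _) _.
  rewrite -mulrBr normrM normrX (@ger0_norm _ 3)// mulrA.
  apply: (@le_trans _ _ (L * `|t - u|)).
    rewrite ler_wpM2r// ler_pM2l// ler_eXn2l ?ltr1n//.
    by rewrite leq_add// ?leq_mul2r ?(ltnW kK) ?orbT// ltnW.
  by rewrite mulrC -ler_pdivlMr.
- move=> x x01.
  (* Position [k * M.+1 + j] of the ternary expansion holds bit [k] of the coordinate [x j]. *)
  pose a m := bit (x (inord (m %% M.+1))) (m %/ M.+1).
  exists (digits 3^-1 (fun k => (a k)%:R)).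
    exact/digits01/unit_seq_bool.
  move=> j; rewrite -[RHS]digits_bit//; congr digits; apply/funext => k.
  rewrite /w wave_digits /a modnMDl modn_small// divnMDl// divn_small// addn0.
  by rewrite inord_val.
Qed.

End CubeCurve.

(** * The moment problem on a cube *)

(** Factorial moments of the binomial distribution, as an identity in a commutative ring: the step
    is [k * 'C(N, k) = N * 'C(N.-1, k.-1)]. Falling factorials, unlike powers, make it exact, so
    that only numbers remain to be estimated. *)
Lemma sum_ffact_bernstein (A : comPzRingType) (v : A) (a N : nat) :
  \sum_(k < N.+1) (v ^+ k * (1 - v) ^+ (N - k)) *+ ('C(N, k) * k ^_ a) =
  v ^+ a *+ N ^_ a.
Proof.
elim: a N => [|a IH] N.
  rewrite ffactn0 expr0 mulr1n -[RHS](expr1n _ N) -[X in X ^+ N](subrK v) exprDn.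
  by apply: eq_bigr => k _; rewrite ffactn0 muln1 mulrC.
case: N => [|N].
  by rewrite big_ord1 ffact0n muln0 !mulr0n.
rewrite big_ord_recl ffact0n muln0 mulr0n add0r ffactSS.
have -> : v ^+ a.+1 *+ (N.+1 * N ^_ a) = (v * (v ^+ a *+ N ^_ a)) *+ N.+1.
  by rewrite exprS mulrnAr -mulrnA mulnC.
rewrite -IH mulr_sumr -sumrMnl; apply: eq_bigr => k _.
rewrite lift0 subSS ffactSS.
have -> : ('C(N.+1, k.+1) * (k.+1 * k ^_ a) = 'C(N, k) * k ^_ a * N.+1)%N.
  by rewrite mulnA [(_ * k.+1)%N]mulnC -mul_bin_diag -mulnA mulnC.
by rewrite mulrnA exprS -mulrA mulrnAr.
Qed.

Lemma prodr01 (R : realDomainType) (I : Type) (r : seq I) (x : I -> R) :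
  (forall i, 0 <= x i <= 1) -> 0 <= \prod_(i <- r) x i <= 1.
Proof.
move=> x01; elim/big_rec: _ => [|i p _ /andP[p0 p1]]; first by rewrite ler01 lexx.
by have /andP[h0 h1] := x01 i; rewrite mulr_ge0//= mulr_ile1.
Qed.

Lemma prod_dist (R : realType) (I : Type) (r : seq I) (x y : I -> R) :
  (forall i, 0 <= x i <= 1) -> (forall i, 0 <= y i <= 1) ->
  `|\prod_(i <- r) x i - \prod_(i <- r) y i| <= \sum_(i <- r) `|x i - y i|.
Proof.
move=> x01 y01; elim: r => [|i r IH]; first by rewrite !big_nil subrr normr0.
rewrite !big_cons; set p := \prod_(_ <- _) _ in IH *; set q := \prod_(_ <- _) _ in IH *.
have /andP[q0 q1] : 0 <= q <= 1.
  exact: prodr01.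
have -> : x i * p - y i * q = (x i - y i) * q + x i * (p - q) by ring.
apply: le_trans (ler_normD _ _) _; rewrite !normrM; apply: lerD.
  by rewrite ler_piMr// ger0_norm.
apply: le_trans IH; have /andP[h0 h1] := x01 i.
by rewrite ler_piMl// ger0_norm.
Qed.

Lemma expr_dist (R : realType) (x y : R) (a : nat) :
  0 <= x <= 1 -> 0 <= y <= 1 -> `|x ^+ a - y ^+ a| <= `|x - y| *+ a.
Proof.
move=> x01 y01.
have := @prod_dist R _ (index_enum 'I_a) (fun=> x) (fun=> y) (fun=> x01) (fun=> y01).
by rewrite !prodr_const sumr_const card_ord.
Qed.

Lemma ffact_ratio01 (R : realType) (a k N : nat) : (k <= N)%N ->
  0 <= ((k ^_ a)%:R / (N ^_ a)%:R : R) <= 1.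
Proof.
move=> kN; apply/andP; split; first by rewrite divr_ge0.
have [aN|Na] := leqP a N; last by rewrite [N ^_ a]ffact_small// invr0 mulr0 ler01.
rewrite ler_pdivrMr ?ltr0n ?ffact_gt0// mul1r ler_nat !ffact_prod.
by apply: leq_prod => i _; rewrite leq_sub2r.
Qed.

Lemma ffact_ratio_dist (R : realType) (a k N : nat) : (k <= N)%N -> (a <= N)%N ->
  `|(k%:R / N%:R) ^+ a - (k ^_ a)%:R / (N ^_ a)%:R| <= (a * a)%:R / N%:R :> R.
Proof.
move=> kN aN.
rewrite !ffact_prod !natr_prod -prodf_div.
have -> : (k%:R / N%:R) ^+ a = \prod_(i < a) (k%:R / N%:R) :> R.
  by rewrite prodr_const card_ord.
have frac01 (p q : nat) : (p <= q)%N -> 0 <= (p%:R / q%:R : R) <= 1.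
  by move=> pq; have := @ffact_ratio01 R 1 p q pq; rewrite !ffactn1.
apply: le_trans (prod_dist _ _ _) _ => [i|i|].
- exact: frac01.
- by apply: frac01; rewrite leq_sub2r.
apply: (@le_trans _ _ (\sum_(i < a) (a%:R / N%:R))); last first.
  by rewrite sumr_const card_ord -[leLHS]mulr_natl mulrA -natrM.
apply: ler_sum => i _.
have iN : (i < N)%N by rewrite (leq_trans _ aN).
have N0 : 0 < N%:R :> R by rewrite ltr0n (leq_ltn_trans _ iN).
have Ni0 : 0 < (N - i)%:R :> R by rewrite ltr0n subn_gt0.
have ia : i%:R <= a%:R :> R by rewrite ler_nat ltnW.
(* For [k < i] the truncated subtraction makes the second ratio 0, and [k / N] is itself below
   [i / N]. *)
have [ik|ki] := leqP i k; last first.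
  rewrite (eqP (ltnW ki : (k - i == 0)%N)) mul0r subr0 ger0_norm; last first.
    by case/andP: (frac01 _ _ kN).
  by rewrite ler_pM2r ?invr_gt0// ler_nat (leq_trans (ltnW ki))// ltnW.
have -> : k%:R / N%:R - (k - i)%:R / (N - i)%:R = (i%:R / N%:R) * ((N - k)%:R / (N - i)%:R) :> R.
  move: N0 Ni0; rewrite !natrB//; last exact: ltnW.
  by move=> N0 Ni0; field; rewrite !gt_eqF.
rewrite normrM ger0_norm ?divr_ge0//.
have /andP[h0 h1] : 0 <= ((N - k)%:R / (N - i)%:R : R) <= 1 by apply: frac01; rewrite leq_sub2l.
rewrite ger0_norm//; apply: le_trans (_ : i%:R / N%:R <= _); first by rewrite ler_piMr// divr_ge0.
by rewrite ler_pM2r// invr_gt0.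
Qed.

(** A cluster point exists by compactness, and an ultrafilter converges to each of its cluster
    points. *)
Lemma ultra_bounded_cvg (R : realType) (F : set_system nat) (u : nat -> R) (B : R) :
  UltraFilter F -> (forall t, `|u t| <= B) -> cvg (u @ F).
Proof.
move=> FU uB; apply: contrapT => ncvg.
have := @segment_compact R (- B) B.
move=> /(_ (u @ F) _) [|p [_ clp]].
  suff : F (u @^-1` [set` `[- B, B]]) by [].
  by apply: filterE => t /=; rewrite in_itv/= -ler_norml; exact: uB.
apply: ncvg; apply/cvg_ex; exists p => V pV.
case: (in_ultra_setVsetC (u @^-1` V) FU) => // FCV.
have [x [/= ]] := clp (~` V) V FCV pV.
by [].
Qed.

Section CubeMoments.
Variables (R : realType) (A : comAlgType R) (l : {linear A -> R^o}) (n : nat).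
Variable v : 'I_n.+1 -> A.
Hypothesis l_ge0 : forall a b : 'I_n.+1 -> nat,
  0 <= l (\prod_j (v j ^+ a j * (1 - v j) ^+ b j)).

(** Bernstein polynomials of degree [N.+1], so that the coordinates of [point] have a nonzero
    denominator. *)
Let grid N := {ffun 'I_n.+1 -> 'I_N.+2}.

Let weight N (f : grid N) : R :=
  l (\prod_j ((v j ^+ f j * (1 - v j) ^+ (N.+1 - f j)) *+ 'C(N.+1, f j))).

Let point N (f : grid N) (j : 'I_n.+1) : R := (f j)%:R / N.+1%:R.

Let weight_ge0 N (f : grid N) : 0 <= weight f.
Proof.
by rewrite /weight prodrMn linearMn mulrn_wge0.
Qed.

Let point01 N (f : grid N) j : 0 <= point f j <= 1.
Proof.
rewrite /point divr_ge0//= ler_pdivrMr ?ltr0n// mul1r ler_nat.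
by rewrite -ltnS.
Qed.

Let ratio (a : 'I_n.+1 -> nat) N (f : grid N) : R :=
  \prod_j ((f j ^_ a j)%:R / (N.+1 ^_ a j)%:R).

Let sum_weight_ratio a N : (forall j, a j <= N.+1)%N ->
  \sum_(f : grid N) weight f * ratio a f = l (\prod_j v j ^+ a j) :> R.
Proof.
move=> aN.
pose B (j : 'I_n.+1) (k : 'I_N.+2) : A :=
  ((k ^_ a j)%:R / (N.+1 ^_ a j)%:R : R) *:
    ((v j ^+ k * (1 - v j) ^+ (N.+1 - k)) *+ 'C(N.+1, k)).
have -> : \prod_j v j ^+ a j = \prod_j \sum_k B j k.
  apply: eq_bigr => j _; rewrite /B.
  under eq_bigr do rewrite [_ / _]mulrC -scalerA scaler_nat -mulrnA.
  rewrite -scaler_sumr sum_ffact_bernstein -[v j ^+ _ *+ _](@scaler_nat R) scalerA mulVf ?scale1r//.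
  by rewrite pnatr_eq0 -lt0n ffact_gt0.
rewrite bigA_distr_bigA linear_sum; apply: eq_bigr => f _.
by rewrite /B scaler_prod linearZ /= mulrC.
Qed.

Let sum_weight N : \sum_(f : grid N) weight f = l 1.
Proof.
rewrite -[RHS](_ : l (\prod_(j < n.+1) v j ^+ 0) = _); last first.
  by rewrite big1.
rewrite -(@sum_weight_ratio (fun=> 0%N) N)//; apply: eq_bigr => f _.
by rewrite /ratio big1 ?mulr1// => j _; rewrite !ffactn0 divff// oner_eq0.
Qed.

Let moment_cvg (a : 'I_n.+1 -> nat) :
  (fun N => \sum_(f : grid N) weight f * \prod_j point f j ^+ a j) @ \oo -->
  (l (\prod_j v j ^+ a j) : R).
Proof.
(* The weights sum to [l 1], and trading a power for a ratio of falling factorials costs at most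
   [(a j * a j) / N.+1] in each coordinate. *)
pose C : R := l 1 * \sum_j (a j * a j)%:R.
have CN : (fun N => C / N.+1%:R) @ \oo --> (0 : R).
  rewrite -[X in _ --> X](mulr0 C); apply: cvgM; first exact: cvg_cst.
  exact: cvg_harmonic.
apply/cvgrPdist_le => e e0.
have /cvgrPdist_le/(_ _ e0) := CN.
case=> N0 _ hN0.
exists (maxn N0 (\max_j a j)) => // N /=; rewrite geq_max => /andP[N0N aN].
have aN' j : (a j <= N.+1)%N.
  by apply: leqW; apply: leq_trans aN; exact: leq_bigmax.
apply: le_trans (hN0 N N0N); rewrite sub0r normrN.
apply: le_trans (ler_norm _).
rewrite -(sum_weight_ratio aN') -sumrB /C -(sum_weight N) mulr_suml mulr_suml.
apply: le_trans (ler_norm_sum _ _ _) _; apply: ler_sum => f _.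
rewrite -mulrBr normrM ger0_norm// -mulrA; apply: ler_wpM2l => //.
rewrite distrC /ratio.
have fN j : (f j <= N.+1)%N by rewrite -ltnS.
apply: le_trans (prod_dist _ _ _) _ => [j|j|].
- by have /andP[h0 h1] := point01 f j; rewrite exprn_ge0//= exprn_ile1.
- exact: ffact_ratio01.
- rewrite mulr_suml; apply: ler_sum => j _; exact: ffact_ratio_dist.
Qed.

(* The Bernstein weights put mass [weight f] on the points of a grid. Their limit
   along an ultrafilter is a positive functional on bounded functions, pulled back
   to [0, 1] by a section of [cube_curve]. *)
Lemma cube_moments : exists d (S : measurableType d) (P : {measure set S -> \bar R})
    (X : 'I_n.+1 -> S -> R),
  [/\ P setT = (l 1)%:E, forall j, measurable_fun setT (X j),
     forall j s, 0 <= X j s <= 1 &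
     forall a : 'I_n.+1 -> nat,
       Rintegral P setT (fun s => \prod_j X j s ^+ a j) = l (\prod_j v j ^+ a j)].
Proof.
have [D [D01 Duc Dsurj]] := cube_curve R n.
(* [code] is an arbitrary section, with no regularity: for each [N] only its values at finitely many
   points enter. *)
have [code codeP] : exists code : ('I_n.+1 -> R) -> R, forall x, (forall j, 0 <= x j <= 1) ->
    0 <= code x <= 1 /\ forall j, D j (code x) = x j.
  suff /boolp.choice[code h] : forall x : 'I_n.+1 -> R, exists t, (forall j, 0 <= x j <= 1) ->
    0 <= t <= 1 /\ forall j, D j t = x j by exists code.
  move=> x; have [/Dsurj[t t01 tx]|nx] := pselect (forall j, 0 <= x j <= 1).
    by exists t.
  by exists 0 => /nx.
have [F [FU ooF]] := @ultraFilterLemma nat \oo _.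
pose Phi (g : R -> R) N : R := \sum_(f : grid N) weight f * g (code (point f)).
(* On monomials the ordinary limit exists by [moment_cvg]; the ultrafilter extends it to all bounded
   functions, among them the indicators on which the quantile function relies. *)
pose E g : R := lim (Phi g @ F).
have code01 N (f : grid N) : 0 <= code (point f) <= 1.
  by have [] := codeP (point f) (point01 f).
have Phi_bd g B N : (forall t, 0 <= t <= 1 -> `|g t| <= B) -> `|Phi g N| <= l 1 * B.
  move=> gB; apply: le_trans (ler_norm_sum _ _ _) _.
  rewrite -(sum_weight N) mulr_suml; apply: ler_sum => f _.
  by rewrite normrM ger0_norm// ler_wpM2l// gB.
have Phi_cvg g : bounded01 g -> cvg (Phi g @ F).
  by move=> [B gB]; apply: (@ultra_bounded_cvg _ _ _ (l 1 * B)) => N; exact: Phi_bd.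
have E_cvg g x : Phi g @ \oo --> x -> E g = x.
  move=> gx; apply: cvg_lim => //; apply: cvg_trans gx => U; exact: ooF.
have E_lin a f g : bounded01 f -> bounded01 g ->
    E (fun t => a * f t + g t) = a * E f + E g.
  move=> bf bg; apply: cvg_lim => //.
  have -> : Phi (fun t => a * f t + g t) = (fun N => a * Phi f N + Phi g N).
    apply/funext => N; rewrite /Phi mulr_sumr -big_split/=; apply: eq_bigr => h _.
    by ring.
  by apply: cvgD; [apply: cvgM; [exact: cvg_cst|exact: Phi_cvg]|exact: Phi_cvg].
have E_mono f g : bounded01 f -> bounded01 g ->
    (forall t, 0 <= t <= 1 -> f t <= g t) -> E f <= E g.
  move=> bf bg fg; apply: ler_lim; [exact: Phi_cvg|exact: Phi_cvg|].
  by apply: filterE => N; apply: ler_sum => h _; rewrite ler_wpM2l// fg.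
have E1 : E (fun=> 1) = l 1.
  apply: E_cvg.
  have -> : Phi (fun=> 1) = (fun=> l 1).
    by apply/funext => N; rewrite -(sum_weight N); apply: eq_bigr => f _; rewrite mulr1.
  exact: cvg_cst.
have [d [S [P [Q [PT mQ Q01 intQ]]]]] := quantile_representation E_lin E_mono E1.
have D_cont j : continuous (D j).
  move=> t; apply/cvgrPdist_le => e e0; have [r r0 rD] := Duc j e e0.
  by near do apply: rD; apply: cvgr_dist_le.
have mD j : measurable_fun setT (D j) by exact: continuous_measurable_fun.
exists d, S, P, (fun j s => D j (Q s)); split => //.
- by move=> j; exact: measurableT_comp.
move=> a; pose g t : R := \prod_j D j t ^+ a j.
have g01 t : 0 <= g t <= 1.
  by apply: prodr01 => j; have /andP[h0 h1] := D01 j t; rewrite exprn_ge0//= exprn_ile1.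
rewrite [LHS](intQ g).
- apply: E_cvg; have -> : Phi g = (fun N => \sum_(f : grid N) weight f * \prod_j point f j ^+ a j).
    apply/funext => N; apply: eq_bigr => f _; congr (_ * _); apply: eq_bigr => j _.
    by have [_ ->] := codeP (point f) (point01 f).
  exact: moment_cvg.
- by apply: measurable_prod => j _; exact: measurable_funX.
- by exists 1 => t _; have /andP[h0 h1] := g01 t; rewrite ger0_norm.
- move=> e e0.
  (* The errors of the factors add up to at most [\sum_j a j] times [e / K]; the [1 +] keeps [K]
     positive. *)
  pose K : R := 1 + \sum_j (a j)%:R.
  have K0 : 0 < K by rewrite ltr_wpDr// sumr_ge0.
  have eK : 0 < e / K by rewrite divr_gt0.
  have /boolp.choice[r hr] : forall j, exists d : R, 0 < d /\
      forall t u, `|t - u| <= d -> `|D j t - D j u| <= e / K.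
    by move=> j; have [d0 ? ?] := Duc j _ eK; exists d0.
  exists (\big[Num.min/1]_j r j).
    by elim/big_ind: _ => // [x y x0 y0|j _]; [rewrite lt_min x0|case: (hr j)].
  move=> t u _ _ tu.
  apply: le_trans (prod_dist _ _ _) _.
  + by move=> j; have /andP[h0 h1] := D01 j t; rewrite exprn_ge0//= exprn_ile1.
  + by move=> j; have /andP[h0 h1] := D01 j u; rewrite exprn_ge0//= exprn_ile1.
  apply: (@le_trans _ _ (\sum_j (e / K) *+ a j)).
    apply: ler_sum => j _; apply: le_trans (expr_dist _ (D01 j t) (D01 j u)) _.
    rewrite lerMn2r; apply/orP; right.
    apply: (hr j).2; apply: le_trans tu _; exact: bigmin_le.
  under eq_bigr do rewrite -mulr_natr.
  rewrite -mulr_sumr mulrAC ler_pdivrMr// ler_pM2l// /K.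
  by rewrite lerDr.
Unshelve. all: by end_near. Qed.

End CubeMoments.

(** * From the cube to the orthant *)

Section NullSets.
Variables (R : realType) (d : measure_display) (S : measurableType d).
Variable P : {measure set S -> \bar R}.

Lemma integrable_conull (G : set S) (f g : S -> R) :
  measurable G -> P (~` G) = 0 -> measurable_fun setT g ->
  P.-integrable G (EFin \o f) -> (forall s, G s -> f s = g s) ->
  P.-integrable setT (EFin \o g) /\ Rintegral P setT g = Rintegral P G f.
Proof.
move=> mG G0 mg iF fg.
have ig : P.-integrable G (EFin \o g).
  by apply: eq_integrable iF => // s /set_mem Gs; rewrite /= fg.
have iT : P.-integrable setT (EFin \o g).
  apply/(negligible_integrable (measurableC mG) _ _ G0) => //.
    exact/measurable_EFinP.
  by rewrite setTD setCK.
split => //; rewrite /Rintegral (negligible_integral (measurableC mG) _ iT G0)// setTD setCK.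
by congr fine; apply: eq_integral => s /set_mem Gs; rewrite fg.
Qed.

Lemma integrable_ae (G : set S) (f g : S -> R) :
  measurable G -> P (~` G) = 0 -> measurable_fun setT g ->
  P.-integrable setT (EFin \o f) -> (forall s, G s -> f s = g s) ->
  P.-integrable setT (EFin \o g) /\ Rintegral P setT g = Rintegral P setT f.
Proof.
move=> mG G0 mg iF fg.
have iG : P.-integrable G (EFin \o f) by exact: integrableS iF.
have mf : measurable_fun setT f by apply/measurable_EFinP; case/integrableP: iF.
have [-> ->] := integrable_conull mG G0 mg iG fg.
by have [_ ->] := integrable_conull mG G0 mf iG (fun _ _ => erefl).
Qed.

Lemma null_of_Rintegral_le0 (g : S -> R) :
  P.-integrable setT (EFin \o g) -> (forall s, 0 <= g s) -> Rintegral P setT g <= 0 ->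
  measurable [set s | g s = 0] /\ P (~` [set s | g s = 0]) = 0.
Proof.
move=> ig g0 Ig.
have mg : measurable_fun setT g by apply/measurable_EFinP; case/integrableP: ig.
have mG : measurable [set s | g s = 0].
  have -> : [set s | g s = 0] = setT `&` g @^-1` [set 0] by rewrite setTI.
  exact: mg.
split => //.
have I0 : (\int[P]_s (g s)%:E = 0)%E.
  rewrite -[LHS]fineK; last exact: integrable_fin_num.
  congr (_%:E); apply/eqP; rewrite eq_le Ig fine_ge0// integral_ge0// => s _.
  by rewrite lee_fin.
have mEg : measurable_fun setT (EFin \o g) by exact/measurable_EFinP.
have [h _] := ae_eq_integral_abs P measurableT mEg.
have /h [N [mN N0 sN]] : (\int[P]_s `|(EFin \o g) s| = 0)%E.
  by rewrite -[RHS]I0; apply: eq_integral => s _; rewrite /= ger0_norm.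
apply/eqP; rewrite eq_le measure_ge0 andbT -N0; apply: le_measure; rewrite ?inE//.
  exact: measurableC.
move=> s /= gs; apply: sN => /= /(_ I) [] e; exact: gs.
Qed.

Lemma conullI (G1 G2 : set S) : measurable G1 /\ P (~` G1) = 0 -> measurable G2 /\ P (~` G2) = 0 ->
  measurable (G1 `&` G2) /\ P (~` (G1 `&` G2)) = 0.
Proof.
move=> [m1 P1] [m2 P2]; split; first exact: measurableI.
apply: measure_negligible; first by apply: measurableC; exact: measurableI.
by rewrite setCI; apply: negligibleU; apply/negligibleP => //; exact: measurableC.
Qed.

End NullSets.

(** Pointwise counterpart of [sos_1Byexp], by the same recursion. *)
Lemma mulr_expr_le (R : realDomainType) (z : R) (m : nat) : 0 <= z <= 1 ->
  z * (1 - z) ^+ m * m.+1%:R <= 1.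
Proof.
move=> /andP[z0 z1]; have w0 : 0 <= 1 - z by rewrite subr_ge0.
have w1 k : (1 - z) ^+ k <= 1 by rewrite exprn_ile1// lerBlDr lerDl.
elim: m => [|m IH]; first by rewrite expr0 !mulr1.
rewrite -subr_ge0.
have -> : 1 - z * (1 - z) ^+ m.+1 * m.+2%:R =
  (1 - z) * (1 - z * (1 - z) ^+ m * m.+1%:R) + z * (1 - (1 - z) ^+ m.+1).
  by rewrite exprS -(natr1 m.+1); ring.
by rewrite addr_ge0// mulr_ge0// subr_ge0.
Qed.

Section Correspondence.
Variables (R : realType) (A : comAlgType R) (l : {linear A -> R^o}) (n : nat).
Variable v : 'I_n.+1 -> A.
Variables (d : measure_display) (S : measurableType d) (P : {measure set S -> \bar R}).
Variable X : 'I_n.+1 -> S -> R.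
Hypothesis PT : P setT = (l 1)%:E.
Hypothesis mX : forall j, measurable_fun setT (X j).
Hypothesis X01 : forall j s, 0 <= X j s <= 1.
Hypothesis X_moments : forall a : 'I_n.+1 -> nat,
  Rintegral P setT (fun s => \prod_j X j s ^+ a j) = l (\prod_j v j ^+ a j).

(* [corr f p]: [f] and [p] are the values of one polynomial at [X] and at [v]. *)
Inductive corr : (S -> R) -> A -> Prop :=
| corr_monomial a : corr (fun s => \prod_j X j s ^+ a j) (\prod_j v j ^+ a j)
| corr_add f g p q : corr f p -> corr g q -> corr (fun s => f s + g s) (p + q)
| corr_scale c f p : corr f p -> corr (fun s => c * f s) (c *: p).

Lemma corr_mul f g p q : corr f p -> corr g q -> corr (fun s => f s * g s) (p * q).
Proof.
move=> cf; elim: cf g q => [a g q cg|f1 f2 p1 p2 _ IH1 _ IH2 g q cg|c f' p' _ IH g q cg].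
- elim: cg => [b|g1 g2 q1 q2 _ IH1 _ IH2|c g1 q1 _ IH].
  + have -> : (fun s => \prod_j X j s ^+ a j * \prod_j X j s ^+ b j) =
        (fun s => \prod_j X j s ^+ (a j + b j)).
      by apply/funext => s; rewrite -big_split; apply: eq_bigr => j _; rewrite exprD.
    have -> : \prod_j v j ^+ a j * \prod_j v j ^+ b j = \prod_j v j ^+ (a j + b j).
      by rewrite -big_split; apply: eq_bigr => j _; rewrite exprD.
    exact: corr_monomial.
  + by under eq_fun do rewrite mulrDr; rewrite mulrDr; exact: corr_add.
  + by under eq_fun do rewrite mulrCA; rewrite -scalerAr; exact: corr_scale.
- by under eq_fun do rewrite mulrDl; rewrite mulrDl; apply: corr_add; [exact: IH1|exact: IH2].
- by under eq_fun do rewrite -mulrA; rewrite -scalerAl; apply: corr_scale; exact: IH.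
Qed.

Lemma corr_cst c : corr (fun=> c) (c *: 1).
Proof.
have := corr_scale c (corr_monomial (fun=> 0%N)).
rewrite [\prod_j v j ^+ _]big1 //; congr corr.
by apply/funext => s; rewrite big1 ?mulr1.
Qed.

Lemma corr_var j : corr (X j) (v j).
Proof.
have := corr_monomial (fun i => (i == j) : nat).
rewrite (bigD1 j)//= eqxx expr1 big1 ?mulr1 => [|i /negPf->//].
by congr corr; apply/funext => s; rewrite (bigD1 j)//= eqxx expr1 big1 ?mulr1// => i /negPf->.
Qed.

Lemma corr_sub f g p q : corr f p -> corr g q -> corr (fun s => f s - g s) (p - q).
Proof.
move=> cf cg; have := corr_add cf (corr_scale (-1) cg).
by rewrite scaleN1r; congr corr; apply/funext => s; rewrite mulN1r.
Qed.

Lemma corr_exp f p k : corr f p -> corr (fun s => f s ^+ k) (p ^+ k).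
Proof.
move=> cf; elim: k => [|k IH].
  by rewrite expr0 -[X in corr _ X]scale1r; exact: corr_cst.
by under eq_fun do rewrite exprS; rewrite exprS; exact: corr_mul.
Qed.

Lemma corr_sum (I : Type) (r : seq I) (F : I -> S -> R) (p : I -> A) :
  (forall i, corr (F i) (p i)) -> corr (fun s => \sum_(i <- r) F i s) (\sum_(i <- r) p i).
Proof.
move=> cF; elim: r => [|i r IH].
  rewrite big_nil; under eq_fun do rewrite big_nil.
  by rewrite -[X in corr _ X](scale0r 1); exact: corr_cst.
by rewrite big_cons; under eq_fun do rewrite big_cons; exact: corr_add.
Qed.

Lemma corr_prod (I : Type) (r : seq I) (F : I -> S -> R) (p : I -> A) :
  (forall i, corr (F i) (p i)) -> corr (fun s => \prod_(i <- r) F i s) (\prod_(i <- r) p i).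
Proof.
move=> cF; elim: r => [|i r IH].
  rewrite big_nil; under eq_fun do rewrite big_nil.
  by rewrite -[X in corr _ X]scale1r; exact: corr_cst.
by rewrite big_cons; under eq_fun do rewrite big_cons; exact: corr_mul.
Qed.

Lemma corr_measurable f p : corr f p -> measurable_fun setT f.
Proof.
elim=> [a|f1 f2 p1 p2 _ m1 _ m2|c f1 p1 _ m1].
- by apply: measurable_prod => j _; exact: measurable_funX.
- exact: measurable_funD.
- exact: measurable_funM.
Qed.

Lemma corr_bounded f p : corr f p -> exists B, forall s, `|f s| <= B.
Proof.
elim=> [a|f1 f2 p1 p2 _ [B1 b1] _ [B2 b2]|c f1 p1 _ [B b]].
- exists 1 => s; have /andP[h0 h1] : 0 <= \prod_j X j s ^+ a j <= 1.
    by apply: prodr01 => j; have /andP[? ?] := X01 j s; rewrite exprn_ge0//= exprn_ile1.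
  by rewrite ger0_norm.
- by exists (B1 + B2) => s; rewrite (le_trans (ler_normD _ _))// lerD.
- by exists (`|c| * B) => s; rewrite normrM ler_wpM2l.
Qed.

Lemma corr_integrable f p : corr f p -> P.-integrable setT (EFin \o f).
Proof.
move=> cf; have [B fB] := corr_bounded cf.
apply: (@bounded_integrable _ _ _ P setT _ B measurableT) => //.
- by rewrite PT ltry.
- exact: corr_measurable cf.
Qed.

Lemma corr_integral f p : corr f p -> Rintegral P setT f = l p.
Proof.
elim=> [//|f1 f2 p1 p2 c1 i1 c2 i2|c f1 p1 c1 i1].
- by rewrite RintegralD ?i1 ?i2 ?linearD//; [exact: corr_integrable c1|exact: corr_integrable c2].
- by rewrite RintegralZl ?i1 ?linearZ//; exact: corr_integrable c1.
Qed.

End Correspondence.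

Section Representation.
Variables (R : realType) (A : comAlgType R) (l : {linear A -> R^o}) (n : nat).
Variables (x : 'I_n -> A) (y : A).
Let h := 1 + \sum_j x j ^+ 2.
Hypothesis l_yh : forall p, l (y * h * p) = l p.
Hypothesis l_sqr : forall p, 0 <= l (p ^+ 2).
Hypothesis l_xsqr : forall j p, 0 <= l (x j * p ^+ 2).

Let v (j : 'I_n.+1) : A :=
  if unlift ord_max j is Some i then 2^-1 *: 1 + y * x i else y.

Let v_max : v ord_max = y. Proof. by rewrite /v unlift_none. Qed.

Let v_lift i : v (lift ord_max i) = 2^-1 *: 1 + y * x i.
Proof. by rewrite /v liftK. Qed.

Let sos_v j : sos l (v j).
Proof.
rewrite /v; case: (unlift _ _) => [i|]; last exact: sos_y l_yh.
by have := sos_half_addyx l_yh i false; rewrite expr0 scale1r.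
Qed.

Let sos_1Bv j : sos l (1 - v j).
Proof.
rewrite /v; case: (unlift _ _) => [i|]; last exact: sos_1By l_yh.
have := sos_half_addyx l_yh i true; rewrite expr1 scaleN1r; congr sos.
rewrite opprD addrA; congr (_ - _); rewrite -[X in X - _]scale1r -scalerBl.
by congr (_ *: _); lra.
Qed.

Let bernstein_ge0 (a b : 'I_n.+1 -> nat) : 0 <= l (\prod_j (v j ^+ a j * (1 - v j) ^+ b j)).
Proof.
apply: (sos_ge0 l_sqr); apply: sos_prod => j _.
by apply: sos_mul; apply: sos_exp; [exact: sos_v|exact: sos_1Bv].
Qed.

Section Measure.
Variables (d : measure_display) (S : measurableType d) (P : {measure set S -> \bar R}).
Variable X : 'I_n.+1 -> S -> R.
Hypothesis PT : P setT = (l 1)%:E.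
Hypothesis mX : forall j, measurable_fun setT (X j).
Hypothesis X01 : forall j s, 0 <= X j s <= 1.
Hypothesis X_moments : forall a : 'I_n.+1 -> nat,
  Rintegral P setT (fun s => \prod_j X j s ^+ a j) = l (\prod_j v j ^+ a j).

Let corr := corr v X.
Let corr_measurable := @corr_measurable R A n v d S X mX.
Let corr_integrable := @corr_integrable R A l n v d S P X PT mX X01.
Let corr_integral := @corr_integral R A l n v d S P X PT mX X01 X_moments.

Let Y s := X ord_max s.
Let V i s := X (lift ord_max i) s - 2^-1.

Let Y01 s : 0 <= Y s <= 1. Proof. exact: X01. Qed.

Let corr_Y : corr Y y. Proof. by rewrite -v_max; exact: corr_var. Qed.

Let corr_V i : corr (V i) (y * x i).
Proof.
have -> : y * x i = v (lift ord_max i) - 2^-1 *: 1 by rewrite v_lift addrAC subrr add0r.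
apply: corr_sub; [exact: corr_var|exact: corr_cst].
Qed.

Let corr_1BY : corr (fun s => 1 - Y s) (1 - y).
Proof. by rewrite -[X in X - _]scale1r; apply: corr_sub => //; exact: corr_cst. Qed.

Let q m s := \sum_(0 <= i < m) (1 - Y s) ^+ i.
Let q' m : A := \sum_(0 <= i < m) (1 - y) ^+ i.

Let corr_q m : corr (q m) (q' m).
Proof. by apply: corr_sum => i; exact: corr_exp. Qed.

(** Inserting [y * h] turns [q' m] into [h * (y * q' m)], and [y * q' m] telescopes to
    [1 - (1 - y) ^+ m]. *)
Let l_q m r : l (q' m * r) = l (h * r) - l (h * (1 - y) ^+ m * r).
Proof.
rewrite -linearB -[LHS]l_yh; congr (l _).
have -> : y * h * (q' m * r) = h * (y * q' m) * r by ring.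
have -> : y * q' m = 1 - (1 - y) ^+ m.
  rewrite /q' big_mkord -[RHS]opprB subrX1 -mulNr; congr (_ * _); ring.
by ring.
Qed.

Let q_ge0 m s : 0 <= q m s.
Proof.
by apply: sumr_ge0 => i _; rewrite exprn_ge0// subr_ge0; case/andP: (Y01 s).
Qed.

Let D := [set s | 0 < Y s].

Let mD : measurable D.
Proof.
have -> : D = setT `&` Y @^-1` `]0, +oo[.
  by rewrite setTI; apply/seteqP; split => s; rewrite /D/= in_itv/= andbT.
exact: (mX ord_max).
Qed.

(** Where [Y = 0], [q m] equals [m]. Hence [m] times the mass of this set is at most [l (q' m)],
    which stays below [l h] for all [m]. *)
Let D_conull : P (~` D) = 0.
Proof.
have PTfin : (P setT < +oo)%E by rewrite PT ltry.
have fin : (P (~` D) < +oo)%E.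
  apply: (@le_lt_trans _ _ (P setT)); last by rewrite PT ltry.
  by apply: le_measure; rewrite ?inE//; exact: measurableC.
have mI : measurable_fun setT (\1_(~` D) : S -> R).
  by apply: measurable_indic; exact: measurableC.
have PR : Rintegral P setT (\1_(~` D) : S -> R) = fine (P (~` D)).
  by rewrite /Rintegral integral_indic ?setIT//; exact: measurableC.
have hm (m : nat) : m%:R * fine (P (~` D)) <= l h.
  rewrite -PR -RintegralZl//; last first.
    by apply: (@bounded_integrable _ _ _ P setT _ 1 measurableT PTfin mI) => s _;
      rewrite indicE; case: (_ \in _); rewrite ?normr0 ?normr1.
  apply: (@le_trans _ _ (Rintegral P setT (q m))).
    apply: le_Rintegral => //.
    - apply: (@bounded_integrable _ _ _ P setT _ m%:R measurableT PTfin).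
        exact: measurable_funM.
      move=> s _ /=; case: (_ \in _); rewrite ?mulr1 ?mulr0 ?normr0//.
      by rewrite ger0_norm.
    - exact: corr_integrable (corr_q m).
    move=> s _; have [sD|_] := boolP (s \in ~` D); last by rewrite mulr0; exact: q_ge0.
    have Y0 : Y s = 0.
      apply/eqP; rewrite eq_le (proj1 (andP (Y01 s))) andbT leNgt; apply/negP.
      by move: sD; rewrite inE.
    by rewrite mulr1 /q Y0 subr0 big_mkord; under eq_bigr do rewrite expr1n; rewrite sumr_const card_ord.
  rewrite (corr_integral (corr_q m)) -[q' m]mulr1 l_q mulr1 gerBl.
  by have /andP[] := tail_bound l_sqr l_yh m (sos1 l).
apply/eqP; rewrite -[X in X == _]fineK ?ge0_fin_numE// eqe; apply/eqP.
have p0 : 0 <= fine (P (~` D)) by rewrite fine_ge0.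
apply/eqP; rewrite eq_le p0 andbT leNgt; apply/negP => pp.
have := hm (Num.truncn (l h / fine (P (~` D)))).+1; rewrite leNgt => /negP; apply.
by rewrite -ltr_pdivrMr// truncnS_gt.
Qed.

Let mYV k : measurable_fun setT (fun s => (Y s)^-1 ^+ k).
Proof.
apply: measurable_funX.
have -> : (fun s => (Y s)^-1) = @powR R ^~ (-1) \o Y.
  by apply/funext => s /=; rewrite powR_inv1//; case/andP: (Y01 s).
by apply: measurableT_comp; [exact: measurable_powR|exact: mX].
Qed.

(* [q m] increases to [1 / Y], and [q' m] tends to [h] under [l] by [tail_bound]. *)
Let sqr_step k f p : corr f p ->
  (forall g r, corr g r -> P.-integrable setT (EFin \o (fun s => (Y s)^-1 ^+ k * g s)) /\
     Rintegral P setT (fun s => (Y s)^-1 ^+ k * g s) = l (h ^+ k * r)) ->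
  P.-integrable setT (EFin \o (fun s => (Y s)^-1 ^+ k.+1 * f s ^+ 2)) /\
  Rintegral P setT (fun s => (Y s)^-1 ^+ k.+1 * f s ^+ 2) = l (h ^+ k.+1 * p ^+ 2).
Proof.
move=> cf IH.
have mf := corr_measurable cf.
have mfk : measurable_fun setT (fun s => (Y s)^-1 ^+ k.+1 * f s ^+ 2).
  by apply: measurable_funM => //; exact: measurable_funX.
(* The square serves twice: it makes [u] nonnegative and monotone in [m] for monotone convergence,
   and it makes [h ^+ k * p ^+ 2] a sum of squares for [tail_bound]. *)
pose u m s := (Y s)^-1 ^+ k * (q m s * f s ^+ 2).
have cu m : corr (fun s => q m s * f s ^+ 2) (q' m * p ^+ 2).
  by apply: corr_mul; [exact: corr_q|exact: corr_exp].
have mu m : measurable_fun setT (u m).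
  by apply: measurable_funM => //; exact: corr_measurable (cu m).
have u_ge0 m s : 0 <= u m s.
  rewrite /u mulr_ge0// ?exprn_ge0 ?invr_ge0//; first by case/andP: (Y01 s).
  by rewrite mulr_ge0// sqr_ge0.
have uD m : (\int[P]_(s in D) (u m s)%:E = (l (q' m * (h ^+ k * p ^+ 2)))%:E)%E.
  have [iu Iu] := IH _ _ (cu m).
  rewrite -[X in l X]mulrCA -Iu /Rintegral.
  rewrite -[LHS]fineK; last exact: integrable_fin_num (integrableS _ _ _ iu).
  congr (fine _)%:E; rewrite [RHS](negligible_integral (measurableC mD) _ iu D_conull)//.
  by rewrite setTD setCK.
have lim_u s : D s -> (u m s)%:E @[m --> \oo] --> ((Y s)^-1 ^+ k.+1 * f s ^+ 2)%:E.
  move=> Ds; apply/fine_cvgP; split; first exact: nearW.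
  rewrite exprSr -mulrA; apply: cvgM; first exact: cvg_cst.
  apply: cvgM; last exact: cvg_cst.
  have := @cvg_geometric_series R 1 (1 - Y s).
  have -> : 1 / (1 - (1 - Y s)) = (Y s)^-1 by rewrite opprB addrCA subrr addr0 div1r.
  have -> : series (geometric 1 (1 - Y s)) = q ^~ s.
    by apply/funext => m; apply: eq_bigr => i _; rewrite /= mul1r.
  by apply; have /andP[h0 h1] := Y01 s; rewrite ger0_norm ?subr_ge0// gtrBl.
have cvgD : (\int[P]_(s in D) (u m s)%:E @[m --> \oo] -->
    \int[P]_(s in D) ((Y s)^-1 ^+ k.+1 * f s ^+ 2)%:E)%E.
  have -> : (\int[P]_(s in D) ((Y s)^-1 ^+ k.+1 * f s ^+ 2)%:E =
      \int[P]_(s in D) limn (fun m => (u m s)%:E))%E.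
    by apply: eq_integral => s /set_mem Ds; apply/esym/cvg_lim => //; exact: lim_u.
  apply: (@cvg_monotone_convergence _ _ _ P D mD (fun m s => (u m s)%:E)).
  - by move=> m; apply/measurable_EFinP; exact: measurable_funTS.
  - by move=> m s _; rewrite lee_fin.
  - move=> s _ m m' mm'; rewrite lee_fin /u ler_wpM2l//.
      by rewrite exprn_ge0// invr_ge0; case/andP: (Y01 s).
    rewrite ler_wpM2r ?sqr_ge0// /q (big_cat_nat (leq0n m) mm')//= lerDl sumr_ge0// => i _.
    by rewrite exprn_ge0// subr_ge0; case/andP: (Y01 s).
pose L := l (h ^+ k.+1 * p ^+ 2).
have cvgL : (\int[P]_(s in D) (u m s)%:E @[m --> \oo] --> L%:E)%E.
  pose t m := l (h * (1 - y) ^+ m * (h ^+ k * p ^+ 2)).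
  have -> : (fun m => \int[P]_(s in D) (u m s)%:E)%E = (fun m => (L - t m)%:E).
    by apply/funext => m; rewrite uD l_q mulrA -exprS.
  suff t0 : t @ \oo --> (0 : R).
    apply/fine_cvgP; split; first exact: nearW.
    have := cvgB (@cvg_cst _ L _ \oo _) t0; rewrite subr0; exact.
  have sos_r : sos l (h ^+ k * p ^+ 2).
    by apply: sos_mul; [apply: sos_exp; exact: sos_h|exact: sos_sqr].
  have bnd m := tail_bound l_sqr l_yh m sos_r.
  apply: (@squeeze_cvgr _ _ _ _ (fun=> 0) (fun m => l (h ^+ 2 * (h ^+ k * p ^+ 2)) / m.+1%:R)).
  - by apply: nearW => m; exact: bnd.
  - exact: cvg_cst.
  - rewrite -[X in _ --> X](mulr0 (l (h ^+ 2 * (h ^+ k * p ^+ 2)))).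
    by apply: cvgM; [exact: cvg_cst|exact: cvg_harmonic].
have ID : (\int[P]_(s in D) ((Y s)^-1 ^+ k.+1 * f s ^+ 2)%:E = L%:E)%E.
  exact: cvg_unique cvgD cvgL.
have iD : P.-integrable D (EFin \o (fun s => (Y s)^-1 ^+ k.+1 * f s ^+ 2)).
  apply/integrableP; split; first by apply/measurable_EFinP; exact: measurable_funTS.
  under eq_integral => s _.
    rewrite /= ger0_norm; last first.
      by rewrite mulr_ge0 ?sqr_ge0// exprn_ge0// invr_ge0; case/andP: (Y01 s).
    over.
  by rewrite ID ltry.
have [-> ->] := integrable_conull mD D_conull mfk iD (fun _ _ => erefl).
by split => //; rewrite /Rintegral ID.
Qed.

(** Polarization, [4 f = (f + 1)^2 - (f - 1)^2], passes from squares to all [f]. The induction on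
    [k] needs every [f] at once, since [sqr_step] uses level [k] for [q m * f ^ 2]. *)
Let unbounded_integral k f p : corr f p ->
  P.-integrable setT (EFin \o (fun s => (Y s)^-1 ^+ k * f s)) /\
  Rintegral P setT (fun s => (Y s)^-1 ^+ k * f s) = l (h ^+ k * p).
Proof.
elim: k f p => [|k IH] f p cf.
  under [X in EFin \o X]eq_fun do rewrite expr0 mul1r.
  under [X in Rintegral P setT X]eq_fun do rewrite expr0 mul1r.
  by rewrite expr0 mul1r; split; [exact: corr_integrable cf|exact: corr_integral].
have cf1 : corr (fun s => f s + 1) (p + 1 *: 1) by apply: corr_add => //; exact: corr_cst.
have cf2 : corr (fun s => f s - 1) (p - 1 *: 1) by apply: corr_sub => //; exact: corr_cst.
have [i1 I1] := sqr_step cf1 IH; have [i2 I2] := sqr_step cf2 IH.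
have e s : (Y s)^-1 ^+ k.+1 * f s = 4^-1 * ((Y s)^-1 ^+ k.+1 * (f s + 1) ^+ 2 -
                                          (Y s)^-1 ^+ k.+1 * (f s - 1) ^+ 2) by field.
have ib := integrableB measurableT i1 i2.
have iz := integrableZl measurableT 4^-1 ib.
under [X in EFin \o X]eq_fun do rewrite e.
under [X in Rintegral P setT X]eq_fun do rewrite e.
split; first exact: iz.
rewrite RintegralZl//.
rewrite RintegralB// I1 I2 -linearB -[LHS](linearZ_LR l); congr (l _).
rewrite scale1r -mulrBr scalerAr; congr (_ * _).
have -> : (p + 1) ^+ 2 - (p - 1) ^+ 2 = 4%:R *: p :> A.
  by rewrite scaler_nat -mulr_natl; ring.
by rewrite scalerA mulVf ?scale1r// pnatr_eq0.
Qed.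

(** Equation of the sphere; for [Y > 0] its vanishing says that [Y] is [1 / (1 + |V / Y|^2)]. *)
Let rel s := Y s ^+ 2 + \sum_i V i s ^+ 2 - Y s.

Let corr_rel : corr rel (y ^+ 2 + \sum_i (y * x i) ^+ 2 - y).
Proof.
apply: corr_sub; last exact: corr_Y.
apply: corr_add; first exact: corr_exp corr_Y.
by apply: corr_sum => i; apply: corr_exp; exact: corr_V.
Qed.

(** The element matching [rel] is [w = y * h * y - y], and [l (w ^+ 2) = 0] because
    [w ^+ 2 = y * h * (y * w) - y * w]. *)
Let rel0 : measurable [set s | rel s ^+ 2 = 0] /\ P (~` [set s | rel s ^+ 2 = 0]) = 0.
Proof.
have c2 := corr_exp 2 corr_rel.
apply: null_of_Rintegral_le0 => [|s|]; [exact: corr_integrable c2|exact: sqr_ge0|].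
rewrite (corr_integral c2) le_eqVlt; apply/orP; left; apply/eqP.
set w := _ - y.
have -> : w = y * h * y - y.
  rewrite /w; under eq_bigr do rewrite exprMn; rewrite -mulr_sumr /h; ring.
have -> : (y * h * y - y) ^+ 2 = y * h * (y * (y * h * y - y)) - y * (y * h * y - y) by ring.
by rewrite linearB l_yh subrr.
Qed.

Let N i s := Y s * Num.max 0 (- V i s).

Let N_ge0 i s : 0 <= N i s.
Proof. by rewrite /N mulr_ge0// ?le_max ?lexx//; case/andP: (Y01 s). Qed.

(* [l_xsqr] is tested on [p = y (1 - 2 y x_i) ^ m], which blows up where [x_i < 0]
   and makes the contribution of [x_i >= 0] negligible. *)
Let N_integral i : P.-integrable setT (EFin \o N i) /\ Rintegral P setT (N i) <= 0.
Proof.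
have mV : measurable_fun setT (V i) by exact: corr_measurable (corr_V i).
have V12 s : - 2^-1 <= V i s <= 2^-1.
  by have /andP[h0 h1] := X01 (lift ord_max i) s; rewrite /V; apply/andP; split; lra.
have mN : measurable_fun setT (N i).
  apply: measurable_funM; first exact: mX.
  by apply: measurable_maxr => //; exact: measurable_funN.
have iN : P.-integrable setT (EFin \o N i).
  apply: (@bounded_integrable _ _ _ P setT _ 1 measurableT _ mN); first by rewrite PT ltry.
  move=> s _; rewrite ger0_norm//; have /andP[? ?] := Y01 s; have /andP[? ?] := V12 s.
  by rewrite /N mulr_ile1// ?le_max ?lexx// ge_max ler01/=; lra.
split => //.
have key m : Rintegral P setT (N i) * m.+1%:R <= l 1.
  (* [g] represents [x i * p ^+ 2]. Where [V i < 0] the even power is at least 1, so [g <= - N i];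
     elsewhere [N i = 0] and [mulr_expr_le] at [2 * V i] bounds [g] by [1 / (m + 1)]. *)
  pose g s := Y s * (V i s * (1 - 2 * V i s) ^+ m.*2).
  have cg : corr g (y * ((y * x i) * (1 - 2 *: (y * x i)) ^+ m.*2)).
    apply: corr_mul => //; apply: corr_mul; first exact: corr_V.
    apply: corr_exp; rewrite -[X in X - _]scale1r; apply: corr_sub; first exact: corr_cst.
    by apply: corr_scale; exact: corr_V.
  have g_ge0 : 0 <= Rintegral P setT g.
    rewrite (corr_integral cg); have := l_xsqr i (y * (1 - 2 *: (y * x i)) ^+ m).
    congr (0 <= l _); rewrite -mul2n exprM.
    by rewrite exprMn -[in RHS]exprM mulnC exprM; ring.
  have Ngm s : N i s + g s <= m.+1%:R^-1.
    have /andP[Y0 Y1] := Y01 s; have /andP[V0 V1] := V12 s.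
    have m0 : 0 < m.+1%:R :> R by rewrite ltr0n.
    have [Vneg|Vpos] := ltP (V i s) 0.
      have -> : N i s = - (Y s * V i s) by rewrite /N max_r ?mulrN// oppr_ge0 ltW.
      apply: (@le_trans _ _ 0); last by rewrite invr_ge0 ltW.
      rewrite addrC subr_le0 /g ler_wpM2l// ger_nMr//.
      by apply: exprn_ege1; lra.
    have -> : N i s = 0 by rewrite /N max_l ?mulr0// oppr_le0.
    rewrite add0r -[leRHS]mul1r ler_pdivlMr//.
    have h2 : 0 <= 2 * V i s <= 1 by apply/andP; split; lra.
    have := mulr_expr_le m.*2 h2; set E := _ ^+ _ => hE.
    have E0 : 0 <= E by rewrite exprn_ge0//; lra.
    have VE : 0 <= V i s * E by rewrite mulr_ge0.
    apply: (@le_trans _ _ (V i s * E * m.+1%:R)).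
      by rewrite /g -/E ler_wpM2r// ler_piMl.
    apply: le_trans hE; rewrite -mulrA -[leRHS]mulrA; apply: ler_pM => //.
    - by rewrite mulr_ge0.
    - by lra.
    - by rewrite ler_wpM2l// ler_nat -addnn ltnS leq_addr.
  have iNg : P.-integrable setT (EFin \o (fun s => N i s + g s)).
    by have := integrableD measurableT iN (corr_integrable cg); exact.
  rewrite -ler_pdivlMr ?ltr0n//.
  apply: (@le_trans _ _ (Rintegral P setT (fun s => N i s + g s))).
    by rewrite RintegralD ?lerDl//; exact: corr_integrable cg.
  have -> : l 1 / m.+1%:R = Rintegral P setT (fun=> m.+1%:R^-1).
    by rewrite Rintegral_cst// PT mulrC.
  apply: le_Rintegral => //.
  apply: (@bounded_integrable _ _ _ P setT _ m.+1%:R^-1 measurableT _ _) => //.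
    by rewrite PT ltry.
  by move=> s _; rewrite ger0_norm.
rewrite leNgt; apply/negP => pp.
have := key (Num.truncn (l 1 / Rintegral P setT (N i))); rewrite leNgt => /negP; apply.
by rewrite mulrC -ltr_pdivrMr// truncnS_gt.
Qed.

Let sumN0 : measurable [set s | \sum_i N i s = 0] /\ P (~` [set s | \sum_i N i s = 0]) = 0.
Proof.
have [iN IN] := @Rintegral_sum _ _ _ P setT _ (index_enum 'I_n) N measurableT
  (fun i => (N_integral i).1).
apply: null_of_Rintegral_le0 => // [s|]; first exact: sumr_ge0.
by rewrite IN; apply: sumr_le0 => i _; exact: (N_integral i).2.
Qed.

Let G := D `&` ([set s | rel s ^+ 2 = 0] `&` [set s | \sum_i N i s = 0]).

Let G_conull : measurable G /\ P (~` G) = 0.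
Proof. by apply: conullI; [split|exact: conullI]. Qed.

Let T i s := V i s / Y s.

Let T_ge0 s i : G s -> 0 <= T i s.
Proof.
move=> [Ds [_ /= Ns]]; rewrite /T divr_ge0 ?(ltW Ds)//.
have /eqP := psumr_eq0P (fun i _ => N_ge0 i s) Ns (i := i) isT.
rewrite /N mulf_eq0 gt_eqF//= => /eqP Vi.
by rewrite -oppr_le0 -Vi le_max lexx orbT.
Qed.

Let Y_T s : G s -> (1 + \sum_i T i s ^+ 2)^-1 = Y s.
Proof.
move=> [Ds [/= /eqP]]; rewrite expf_eq0/= subr_eq0 => /eqP e _.
have Y0 : Y s != 0 by rewrite gt_eqF.
rewrite -[RHS]invrK; congr (_^-1).
have -> : \sum_i T i s ^+ 2 = (\sum_i V i s ^+ 2) / Y s ^+ 2.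
  by rewrite mulr_suml; apply: eq_bigr => i _; rewrite expr_div_n.
have -> : \sum_i V i s ^+ 2 = Y s - Y s ^+ 2 by rewrite -[X in X - _]e addrAC subrr add0r.
by field.
Qed.

Lemma representation_on_space : exists (T : 'I_n -> S -> R) (G : set S),
  [/\ measurable G /\ P (~` G) = 0, forall i, measurable_fun setT (T i),
      forall s i, G s -> 0 <= T i s &
      forall (a : 'I_n -> nat) b,
        let f s := \prod_i T i s ^+ a i * (1 + \sum_i T i s ^+ 2)^-1 ^+ b in
        P.-integrable setT (EFin \o f) /\
        Rintegral P setT f = l (\prod_i x i ^+ a i * y ^+ b)].
Proof.
have mV i : measurable_fun setT (V i) by exact: corr_measurable (corr_V i).
have mT i : measurable_fun setT (T i).
  have -> : T i = (fun s => (Y s)^-1 ^+ 1 * V i s).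
    by apply/funext => s; rewrite expr1 mulrC.
  exact: measurable_funM.
exists T, G; split; [exact: G_conull|exact: mT|exact: T_ge0|].
move=> a b f.
(* The number of factors [1 / Y] that turn the [V i] into the [T i]; on the side of [l] they become
   [h ^+ k], cancelled by the [y] in each [y * x i]. *)
pose k := (\sum_i a i)%N.
have cVY : corr (fun s => \prod_i V i s ^+ a i * Y s ^+ b) (\prod_i (y * x i) ^+ a i * y ^+ b).
  apply: corr_mul; last exact: corr_exp corr_Y.
  by apply: corr_prod => i; apply: corr_exp; exact: corr_V.
have [iF IF] := unbounded_integral k cVY.
have mf : measurable_fun setT f.
  apply: measurable_funM.
    by apply: measurable_prod => i _; exact: measurable_funX.
  apply: measurable_funX.
  have -> : (fun s => (1 + \sum_i T i s ^+ 2)^-1) =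
      (fun s => (1 + \sum_i T i s ^+ 2) `^ (-1)).
    by apply/funext => s; rewrite powR_inv1// addr_ge0// sumr_ge0// => i _; exact: sqr_ge0.
  apply: (@measurableT_comp _ _ _ _ _ _ (@powR R ^~ (-1))); first exact: measurable_powR.
  apply: measurable_funD => //; apply: measurable_sum => i.
  exact: measurable_funX.
have fE s : G s -> (Y s)^-1 ^+ k * (\prod_i V i s ^+ a i * Y s ^+ b) = f s.
  move=> Gs; rewrite /f Y_T// mulrA; congr (_ * _).
  rewrite /k expr_sum -big_split/=; apply: eq_bigr => i _.
  by rewrite -exprMn mulrC.
have [-> ->] := integrable_ae G_conull.1 G_conull.2 mf iF fE.
split => //; rewrite IF.
under eq_bigr do rewrite exprMn.
rewrite big_split/= -expr_sum -/k.
have red m r : l ((y * h) ^+ m * r) = l r.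
  by elim: m r => [|m IH] r; [rewrite expr0 mul1r|rewrite exprS -mulrA l_yh].
rewrite -[RHS](red k); congr (l _); rewrite exprMn; ring.
Qed.

End Measure.

Lemma orthant_representation : exists d (S : measurableType d) (P : {measure set S -> \bar R})
    (T : 'I_n -> S -> R) (G : set S),
  [/\ measurable G /\ P (~` G) = 0, forall i, measurable_fun setT (T i),
      forall s i, G s -> 0 <= T i s &
      forall (a : 'I_n -> nat) b,
        let f s := \prod_i T i s ^+ a i * (1 + \sum_i T i s ^+ 2)^-1 ^+ b in
        P.-integrable setT (EFin \o f) /\
        Rintegral P setT f = l (\prod_i x i ^+ a i * y ^+ b)].
Proof.
have [d [S [P [X [PT mX X01 XM]]]]] := cube_moments bernstein_ge0.
exists d, S, P; exact: representation_on_space PT mX X01 XM.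
Qed.

End Representation.

(** * Borel sets and measures on R^n *)

Section Borel.
Variables (R : realType) (n : nat).

Definition rational_box (q : {ffun 'I_n -> rat * rat}) : set 'rV[R]_n :=
  [set t | forall i, ratr (q i).1 < t 0 i < ratr (q i).2].

Lemma open_rational_box (U : set 'rV[R]_n) (t : 'rV[R]_n) : open U -> U t ->
  exists2 q, rational_box q t & rational_box q `<=` U.
Proof.
move=> oU Ut; have /nbhs_ballP[e e0 eU] : nbhs t U by exact: open_nbhs_nbhs.
have /boolp.choice[q hq] : forall i : 'I_n, exists q : rat * rat,
    t 0 i - e < ratr q.1 < t 0 i /\ t 0 i < ratr q.2 < t 0 i + e.
  move=> i.
  have /rat_in_itvoo[q1] : t 0 i - e < t 0 i by rewrite ltrBlDr ltrDl.
  have /rat_in_itvoo[q2] : t 0 i < t 0 i + e by rewrite ltrDl.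
  by rewrite !in_itv/= => h2 h1; exists (q1, q2).
exists [ffun i => q i] => [i|u /= uq].
  by rewrite ffunE; have [/andP[_ ->] /andP[->]] := hq i.
apply: eU; split => // i j; rewrite (ord1 i) /ball/=.
have := uq j; rewrite ffunE; have [/andP[a1 _] /andP[_ a2]] := hq j => /andP[b1 b2].
rewrite ltr_norml; apply/andP; split; lra.
Qed.

(** The generating family is left open because both the half-spaces and the open sets are needed. *)
Lemma measurable_rational_box (G : set (set 'rV[R]_n)) q :
  (forall i, measurable_fun setT (fun t : g_sigma_algebraType G => t 0 i : R)) ->
  measurable (rational_box q : set (g_sigma_algebraType G)).
Proof.
move=> mcoord.
have -> : rational_box q = \bigcap_(i in [set: 'I_n])
    (fun t : g_sigma_algebraType G => t 0 i : R) @^-1` `](ratr (q i).1), (ratr (q i).2)[.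
  apply/seteqP; split => [t h i _|t h i]; first by rewrite /= in_itv; exact: h.
  by have := h i I; rewrite /= in_itv.
apply: fin_bigcap_measurable => // i _.
by rewrite -[X in measurable X]setTI; apply: mcoord.
Qed.

Definition halfspaces : set (set 'rV[R]_n) :=
  [set A | exists i (a : R), A = [set t : 'rV[R]_n | a < t 0 i]].

Lemma measurable_fun_coord_halfspaces i :
  measurable_fun setT (fun t : g_sigma_algebraType halfspaces => t 0 i : R).
Proof.
apply: (measurability (@RGenOInfty.G R)) => [|_ [_ [a -> <-]]].
  exact: RGenOInfty.measurableE.
rewrite setTI; apply: sub_sigma_algebra; exists i, a.
by apply/seteqP; split => t; rewrite /= in_itv/= andbT.
Qed.

Lemma open_halfspaces (U : set 'rV[R]_n) : open U -> <<s halfspaces >> U.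
Proof.
move=> oU.
pose F (q : {ffun 'I_n -> rat * rat}) : set (g_sigma_algebraType halfspaces) :=
  if pselect (rational_box q `<=` U) then rational_box q else set0.
have -> : U = \bigcup_q F q.
  apply/seteqP; split => [t Ut|t [q _]].
    have [q qt qU] := open_rational_box oU Ut.
    by exists q => //; rewrite /F; case: pselect.
  by rewrite /F; case: pselect => // qU; exact: qU.
apply: (@countable_bigcupT_measurable _ (g_sigma_algebraType halfspaces)).
  exact: countableP.
move=> q; rewrite /F; case: pselect => [qU|qU] /=; last exact: measurable0.
exact: measurable_rational_box measurable_fun_coord_halfspaces.
Qed.

Lemma measurable_fun_rV d (S : measurableType d) (T : 'I_n -> S -> R) :
  (forall i, measurable_fun setT (T i)) ->
  measurable_fun setT (fun s => \row_i T i s : borelRn R n).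
Proof.
move=> mT.
have mH : measurable_fun setT (fun s => \row_i T i s : g_sigma_algebraType halfspaces).
  apply: (@measurability _ _ S (g_sigma_algebraType halfspaces) _ _ halfspaces) => // _ [_ [i [a ->]] <-].
  have -> : [set: S] `&` (fun s => \row_i T i s) @^-1` [set t : 'rV[R]_n | a < t 0 i] =
      [set: S] `&` T i @^-1` `]a, +oo[.
    by rewrite !setTI; apply/seteqP; split => s; rewrite /= in_itv/= andbT mxE.
  exact: mT.
apply: (@measurability _ _ S (borelRn R n) _ _ (@open 'rV[R]_n)) => // _ [U oU <-].
apply: mH => //; exact: open_halfspaces.
Qed.

Lemma open_halfspace i (a : R) : open [set t : 'rV[R]_n | a < t 0 i].
Proof.
have -> : [set t : 'rV[R]_n | a < t 0 i] = (fun t : 'rV[R]_n => t 0 i) @^-1` [set r | a < r].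
  by [].
by apply: open_comp; [move=> t _; exact: coord_continuous|exact: open_gt].
Qed.

Lemma measurable_fun_coord i : measurable_fun setT (fun t : borelRn R n => t 0 i : R).
Proof.
apply: (measurability (@RGenOInfty.G R)) => [|_ [_ [a -> <-]]].
  exact: RGenOInfty.measurableE.
rewrite setTI; apply: sub_sigma_algebra.
have -> : (fun t : 'rV[R]_n => t 0 i) @^-1` `]a, +oo[ = [set t | a < t 0 i].
  by apply/seteqP; split => t; rewrite /= in_itv/= andbT.
exact: open_halfspace.
Qed.

(** Lindelof's argument: the null neighbourhoods shrink to rational boxes, of which there are
    countably many. *)
Lemma open_cover_null (mu : {measure set (borelRn R n) -> \bar R}) (A : set 'rV[R]_n) :
  (forall t, A t -> exists U : set 'rV[R]_n, [/\ open U, U t & mu U = 0]) -> mu.-negligible A.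
Proof.
move=> hA.
have mbox q := @measurable_rational_box (@open 'rV[R]_n) q measurable_fun_coord.
pose F k : set (borelRn R n) := if unpickle k is Some q then
  (if mu (rational_box q) == 0 then rational_box q else set0) else set0.
apply: (@negligibleS _ _ _ _ (\bigcup_k F k)).
  move=> t /hA[U [oU Ut U0]].
  have [q qt qU] := open_rational_box oU Ut.
  exists (pickle q) => //; rewrite /F pickleK ifT//.
  rewrite eq_le measure_ge0 andbT -U0; apply: le_measure; rewrite ?inE//.
  exact: sub_sigma_algebra.
apply: negligible_bigcup => k; rewrite /F.
case: (unpickle k) => [q|]; last exact: negligible_set0.
by case: ifPn => [/eqP q0|_]; [apply/negligibleP|exact: negligible_set0].
Qed.

End Borel.

(** * Determinacy of a measure by its extended moments *)

Section HalfLine.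
Variable R : realType.

(** The polynomials [(1 - x ^+ m) ^+ (2 ^ m)], known from an elementary proof of the
    Stone-Weierstrass theorem, jump from 1 to 0 at [x = 1/2], since [2 ^ m * x ^ m] tends to 0 or to
    infinity. At [z = 0] the first factor has the limit [1 - 1/e]; the second factor, which tends to
    1 elsewhere, corrects this to 0. *)
Definition halfline_approx (m : nat) (z : R) : R :=
  (1 - (1 - (2^-1 + z) ^+ m) ^+ (2 ^ m)) * (1 - (1 - z ^+ 2) ^+ m).

Let expr01 (x : R) k : 0 <= x <= 1 -> 0 <= x ^+ k <= 1.
Proof. by move=> /andP[h0 h1]; rewrite exprn_ge0//= exprn_ile1. Qed.

Let sub01 (x : R) : 0 <= x <= 1 -> 0 <= 1 - x <= 1.
Proof. by move=> /andP[h0 h1]; apply/andP; split; lra. Qed.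

Let sqr01 (z : R) : - 2^-1 <= z <= 2^-1 -> 0 <= z ^+ 2 <= 1.
Proof. by move=> /andP[h0 h1]; apply/andP; split; nra. Qed.

Let halfadd01 (z : R) : - 2^-1 <= z <= 2^-1 -> 0 <= 2^-1 + z <= 1.
Proof. by move=> /andP[h0 h1]; apply/andP; split; lra. Qed.

Lemma halfline_approx01 m (z : R) : - 2^-1 <= z <= 2^-1 -> 0 <= halfline_approx m z <= 1.
Proof.
move=> z12.
have /andP[a0 a1] : 0 <= 1 - (1 - (2^-1 + z) ^+ m) ^+ (2 ^ m) <= 1.
  exact/sub01/expr01/sub01/expr01/halfadd01.
have /andP[b0 b1] : 0 <= 1 - (1 - z ^+ 2) ^+ m <= 1 by exact/sub01/expr01/sub01/sqr01.
by rewrite /halfline_approx mulr_ge0//= mulr_ile1.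
Qed.

Let bernoulli (x : R) k : 0 <= x <= 1 -> 1 - (1 - x) ^+ k <= k%:R * x.
Proof.
move=> x01; have /andP[x0 x1] := x01.
elim: k => [|k IH]; first by rewrite expr0 subrr mul0r.
have /andP[h0 h1] := expr01 k (sub01 x01).
rewrite exprS -natr1; nra.
Qed.

Lemma cvg_halfline_approx (z : R) : - 2^-1 <= z <= 2^-1 ->
  halfline_approx ^~ z @ \oo --> ((0 < z)%R%:R : R).
Proof.
move=> z12; have /andP[zl zr] := z12.
have w01 := halfadd01 z12; have /andP[w0 w1] := w01.
have h01 m : 0 <= (2^-1 + z) ^+ m <= 1 by exact: expr01 w01.
case: (ltgtP 0 z) => z0; last first.
- have -> : halfline_approx ^~ z = fun=> 0.
    by apply/funext => m; rewrite /halfline_approx -z0 expr0n/= subr0 expr1n subrr mulr0.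
  exact: cvg_cst.
- apply: (@squeeze_cvgr _ _ _ _ (fun=> 0) (fun m => (2 * (2^-1 + z)) ^+ m)).
  + apply: nearW => m; have /andP[-> _] /= := halfline_approx01 m z12.
    have /andP[b0 b1] : 0 <= 1 - (1 - z ^+ 2) ^+ m <= 1 by exact/sub01/expr01/sub01/sqr01.
    have /andP[a0 a1] : 0 <= 1 - (1 - (2^-1 + z) ^+ m) ^+ (2 ^ m) <= 1.
      exact/sub01/expr01/sub01/h01.
    rewrite /halfline_approx; apply: (@le_trans _ _ (1 - (1 - (2^-1 + z) ^+ m) ^+ (2 ^ m))).
      by rewrite ler_piMr.
    by rewrite exprMn -natrX; exact: bernoulli.
  + exact: cvg_cst.
  + by apply: cvg_expr; rewrite ger0_norm; lra.
- have f2 : (fun m => (1 - z ^+ 2) ^+ m) @ \oo --> (0 : R).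
    apply: cvg_expr; rewrite ger0_norm; last by case/andP: (sub01 (sqr01 z12)).
    by rewrite gtrBl exprn_gt0.
  have f1 : (fun m => (1 - (2^-1 + z) ^+ m) ^+ (2 ^ m)) @ \oo --> (0 : R).
    apply: (@squeeze_cvgr _ _ _ _ (fun=> 0) (fun m => ((2 * (2^-1 + z))^-1) ^+ m)).
    + apply: nearW => m; have /andP[-> _] /= := expr01 (2 ^ m) (sub01 (h01 m)).
      (* With [u = (1/2 + z) ^ m] this gives [(1 - u) ^ (2 ^ m) <= 1 / (2 ^ m * u)], a geometric
         sequence of ratio below 1. *)
      have := mulr_expr_le (2 ^ m) (h01 m).
      have /andP[] := expr01 (2 ^ m) (sub01 (h01 m)).
      set E := _ ^+ (2 ^ m) => E0 _.
      have : 0 < (2^-1 + z) ^+ m by rewrite exprn_gt0//; lra.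
      set u := _ ^+ m => u0 hE.
      have p0 : 0 < 2 ^+ m :> R by rewrite exprn_gt0.
      rewrite exprVn exprMn -[leRHS]div1r ler_pdivlMr ?mulr_gt0//.
      apply: le_trans hE; rewrite -[(2 ^ m).+1%:R]natr1 natrX.
      have uE : 0 <= u * E by rewrite mulr_ge0// ltW.
      by rewrite -/u; nra.
    + exact: cvg_cst.
    + apply: cvg_expr; rewrite ger0_norm ?invr_ge0; last lra.
      by rewrite invf_lt1; lra.
  have := cvgM (cvgB (@cvg_cst _ (1 : R) _ \oo _) f1) (cvgB (@cvg_cst _ (1 : R) _ \oo _) f2).
  by rewrite subr0 mulr1; exact.
Qed.

End HalfLine.

(* The point [(t, 1 / (1 + |t|^2))] of R^(n+1), the added coordinate being last as
   in [mnm_ext]. *)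
Definition ext_coord (R : realType) (n : nat) (j : 'I_n.+1) (t : 'rV[R]_n) : R :=
  if unlift ord_max j is Some i then t 0 i else (1 + \sum_i t 0 i ^+ 2)^-1.

Section Coordinates.
Variables (R : realType) (n : nat).
Implicit Types t : 'rV[R]_n.

Lemma ext_coord_lift i t : ext_coord (lift ord_max i) t = t 0 i.
Proof. by rewrite /ext_coord liftK. Qed.

Lemma ext_coord_max t : ext_coord ord_max t = (1 + \sum_i t 0 i ^+ 2)^-1.
Proof. by rewrite /ext_coord unlift_none. Qed.

Lemma one_add_sqr_gt0 t : 0 < 1 + \sum_i t 0 i ^+ 2.
Proof. by rewrite ltr_wpDr// sumr_ge0// => i _; exact: sqr_ge0. Qed.

Lemma ext_coord_max_gt0 t : 0 < ext_coord ord_max t.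
Proof. by rewrite ext_coord_max invr_gt0 one_add_sqr_gt0. Qed.

Lemma ext_coord_max_le1 t : ext_coord ord_max t <= 1.
Proof.
rewrite ext_coord_max invf_le1 ?one_add_sqr_gt0// lerDl sumr_ge0// => i _.
exact: sqr_ge0.
Qed.

Lemma ext_coord_max_mul t : ext_coord ord_max t * (1 + \sum_i t 0 i ^+ 2) = 1.
Proof. by rewrite ext_coord_max mulVf// gt_eqF// one_add_sqr_gt0. Qed.

Lemma ext_coord_max_mul_norm t i : `|ext_coord ord_max t * t 0 i| <= 2^-1.
Proof.
have e0 := ext_coord_max_gt0 t; have e1 := ext_coord_max_mul t.
have h : t 0 i ^+ 2 <= \sum_i t 0 i ^+ 2.
  by rewrite (bigD1 i)//= lerDl sumr_ge0// => k _; exact: sqr_ge0.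
move: e0 e1 h; set e := ext_coord _ _; set s := \sum_(_ < _) _; set u := t 0 i => e0 e1 h.
have k1 : 0 <= e * (s - u ^+ 2) by rewrite mulr_ge0 ?subr_ge0 ?(ltW e0).
have k2 : 0 <= e * (1 - u) ^+ 2 by rewrite mulr_ge0 ?sqr_ge0// ltW.
have k3 : 0 <= e * (1 + u) ^+ 2 by rewrite mulr_ge0 ?sqr_ge0// ltW.
rewrite ler_norml; apply/andP; split; nra.
Qed.

Lemma measurable_ext_coord j : measurable_fun setT (ext_coord j : borelRn R n -> R).
Proof.
rewrite /ext_coord; case: (unlift _ _) => [i|]; first exact: measurable_fun_coord.
have -> : (fun t : borelRn R n => (1 + \sum_i (t : 'rV[R]_n) 0 i ^+ 2)^-1) =
    (fun t : borelRn R n => (1 + \sum_i (t : 'rV[R]_n) 0 i ^+ 2) `^ (-1)).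
  by apply/funext => t; rewrite powR_inv1// ltW// one_add_sqr_gt0.
apply: (@measurableT_comp _ _ _ _ _ _ (@powR R ^~ (-1))); first exact: measurable_powR.
apply: measurable_funD => //; apply: measurable_sum => i.
by apply: measurable_funX; exact: measurable_fun_coord.
Qed.

Lemma measurable_ext_monomial (a : 'I_n.+1 -> nat) :
  measurable_fun setT (fun t : borelRn R n => \prod_j ext_coord j t ^+ a j).
Proof. by apply: measurable_prod => j _; apply: measurable_funX; exact: measurable_ext_coord. Qed.

End Coordinates.

Section Uniqueness.
Variables (R : realType) (n : nat) (mu nu : {measure set (borelRn R n) -> \bar R}).
Let mon (a : 'I_n.+1 -> nat) (t : borelRn R n) := \prod_j ext_coord j t ^+ a j.
Hypothesis mu_int : forall a, mu.-integrable setT (EFin \o mon a).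
Hypothesis nu_int : forall a, nu.-integrable setT (EFin \o mon a).
Hypothesis mu_nu : forall a, Rintegral mu setT (mon a) = Rintegral nu setT (mon a).

(** [corr] serves here only to describe the algebra generated by the [ext_coord]; its second
    argument is a dummy, with all generators sent to 0. *)
Let alg f := exists p : R^o, corr (fun=> 0 : R^o) (@ext_coord R n : _ -> borelRn R n -> R) f p.

Let alg_integral f : alg f -> [/\ mu.-integrable setT (EFin \o f),
  nu.-integrable setT (EFin \o f) & Rintegral mu setT f = Rintegral nu setT f].
Proof.
move=> [p]; elim=> [a|f1 f2 _ _ _ [m1 n1 e1] _ [m2 n2 e2]|c f1 _ _ [m1 n1 e1]].
- by split; [exact: mu_int|exact: nu_int|exact: mu_nu].
- split; [exact: (integrableD measurableT m1 m2)|exact: (integrableD measurableT n1 n2)|].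
  by rewrite !RintegralD// e1 e2.
- split; [exact: (integrableZl measurableT c m1)|exact: (integrableZl measurableT c n1)|].
  by rewrite !RintegralZl// e1.
Qed.

Let alg_coord j : alg (ext_coord j). Proof. by eexists; exact: corr_var. Qed.

Let alg_cst c : alg (fun=> c). Proof. by eexists; exact: corr_cst. Qed.

Let alg_add f g : alg f -> alg g -> alg (fun t => f t + g t).
Proof. by move=> [p cp] [q cq]; eexists; exact: corr_add cp cq. Qed.

Let alg_sub f g : alg f -> alg g -> alg (fun t => f t - g t).
Proof. by move=> [p cp] [q cq]; eexists; exact: corr_sub cp cq. Qed.

Let alg_mul f g : alg f -> alg g -> alg (fun t => f t * g t).
Proof. by move=> [p cp] [q cq]; eexists; exact: corr_mul cp cq. Qed.

Let alg_exp f k : alg f -> alg (fun t => f t ^+ k).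
Proof. by move=> [p cp]; eexists; exact: corr_exp cp. Qed.

(* The factor [ext_coord ord_max t] keeps the multiple of [t_j - a] bounded. *)
Let sep (q : 'I_n * R) (t : borelRn R n) : R :=
  (1 + 2 * `|q.2|)^-1 * (ext_coord ord_max t * (ext_coord (lift ord_max q.1) t - q.2)).

(** As [|y t_j| <= 1/2] and [y <= 1], the product [y (t_j - a)] is at most [1/2 + |a|] in absolute
    value, half of the denominator in [sep]. *)
Let sep_half q t : - 2^-1 <= sep q t <= 2^-1.
Proof.
rewrite /sep ext_coord_lift; have h := ext_coord_max_mul_norm t q.1.
have e0 := ext_coord_max_gt0 t; have e1 := ext_coord_max_le1 t.
rewrite -ler_norml normrM gtr0_norm; last by rewrite invr_gt0 ltr_wpDr// mulr_ge0.
rewrite mulrC ler_pdivrMr; last by rewrite ltr_wpDr// mulr_ge0.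
rewrite mulrBr; apply: le_trans (ler_normB _ _) _.
rewrite mulrDr mulr1 mulKf// lerD// normrM gtr0_norm//.
by rewrite ler_piMl.
Qed.

Let sep_gt0 q t : (0 < sep q t) = (q.2 < (t : 'rV[R]_n) 0 q.1).
Proof.
rewrite /sep ext_coord_lift pmulr_rgt0; last by rewrite invr_gt0 ltr_wpDr// mulr_ge0.
by rewrite pmulr_rgt0 ?subr_gt0// ext_coord_max_gt0.
Qed.

Let alg_sep q : alg (sep q).
Proof.
by apply: alg_mul; [exact: alg_cst|apply: alg_mul => //; apply: alg_sub => //; exact: alg_cst].
Qed.

(** Indexed by lists, so that intersection is concatenation and the whole space is the empty
    list. *)
Let corner (s : seq ('I_n * R)) : set (borelRn R n) :=
  [set t | all (fun q => q.2 < (t : 'rV[R]_n) 0 q.1) s].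

Let approx (s : seq ('I_n * R)) m t := \prod_(q <- s) halfline_approx m (sep q t).

Let alg_approx s m : alg (approx s m).
Proof.
rewrite /approx; elim: s => [|q s IH].
  by under eq_fun do rewrite big_nil; exact: alg_cst.
under eq_fun do rewrite big_cons; apply: alg_mul => //; apply: alg_mul.
  apply: alg_sub; first exact: alg_cst.
  apply: alg_exp; apply: alg_sub; first exact: alg_cst.
  by apply: alg_exp; apply: alg_add; first exact: alg_cst.
apply: alg_sub; first exact: alg_cst.
by apply: alg_exp; apply: alg_sub; [exact: alg_cst|exact: alg_exp].
Qed.

Let measurable_corner s : measurable (corner s).
Proof.
elim: s => [|q s IH].
  by have -> : corner [::] = setT by apply/seteqP; split.
have -> : corner (q :: s) = [set t | q.2 < (t : 'rV[R]_n) 0 q.1] `&` corner s.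
  by apply/seteqP; split => t; rewrite /corner/= => /andP.
apply: measurableI => //; apply: sub_sigma_algebra; exact: open_halfspace.
Qed.

Let cvg_approx s t : approx s ^~ t @ \oo --> (\1_(corner s) t : R).
Proof.
have -> : (\1_(corner s) t : R) = \prod_(q <- s) (0 < sep q t)%R%:R.
  rewrite indicE; have -> : (t \in corner s) = all (fun q => q.2 < (t : 'rV[R]_n) 0 q.1) s.
    by apply/idP/idP; rewrite inE.
  elim: s => [|q s IH]; first by rewrite big_nil.
  by rewrite big_cons -IH sep_gt0 /=; case: (_ < _); rewrite ?mul1r ?mul0r.
rewrite /approx; elim: s => [|q s IH].
  by rewrite big_nil; under eq_fun do rewrite big_nil; exact: cvg_cst.
rewrite big_cons; under eq_fun do rewrite big_cons; apply: cvgM => //.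
exact: cvg_halfline_approx.
Qed.

Let approx01 s m t : 0 <= approx s m t <= 1.
Proof. by apply: prodr01 => q; exact: halfline_approx01. Qed.

Let corner_integral (rho : {measure set (borelRn R n) -> \bar R}) s :
  (forall a, rho.-integrable setT (EFin \o mon a)) ->
  (\int[rho]_t (approx s m t)%:E @[m --> \oo] --> rho (corner s))%E.
Proof.
move=> ri.
have mf m : measurable_fun setT (EFin \o approx s m).
  have [iF _ _] := alg_integral (alg_approx s m).
  exact: measurable_int iF.
have i1 : rho.-integrable setT (cst 1%:E).
  apply: eq_integrable (ri (fun=> 0%N)) => // t _ /=.
  by rewrite /mon big1.
have mI : measurable_fun setT (EFin \o \1_(corner s) : borelRn R n -> \bar R).
  exact/measurable_EFinP/measurable_indic.
have cI : {ae rho, forall t, setT t -> (EFin \o approx s m) t @[m --> \oo] -->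
    (EFin \o \1_(corner s)) t}.
  by apply: aeW => t _; apply/fine_cvgP; split; [exact: nearW|exact: cvg_approx].
have bI : {ae rho, forall t m, setT t -> (`|(EFin \o approx s m) t| <= cst 1%:E t)%E}.
  apply: aeW => t m _; rewrite /= lee_fin.
  by have /andP[h0 h1] := approx01 s m t; rewrite ger0_norm.
have [_ _] := dominated_convergence measurableT mf mI cI i1 bI.
by rewrite integral_indic// setIT; exact.
Qed.

(** By dominated convergence the measures agree on the corners, which are closed under intersection
    and generate the Borel sets; the zero exponent gives finite mass. *)
Lemma borel_measure_unique (A : set (borelRn R n)) : measurable A -> mu A = nu A.
Proof.
have eq_corner s : mu (corner s) = nu (corner s).
  have := corner_integral (s := s) nu_int.
  have -> : (fun m => \int[nu]_t (approx s m t)%:E)%E = (fun m => \int[mu]_t (approx s m t)%:E)%E.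
    apply/funext => m; have [i1 i2 e] := alg_integral (alg_approx s m).
    rewrite -[LHS]fineK; last exact: integrable_fin_num i2.
    rewrite -[RHS]fineK; last exact: integrable_fin_num i1.
    by congr (_%:E); exact: esym e.
  move=> h; exact: (cvg_unique _ (corner_integral (s := s) mu_int) h).
move=> mA.
pose H : set (set (borelRn R n)) := [set X | range corner X /\ X `<=` setT].
have HE : H = range corner by apply/seteqP; split => [X []|X XH]; [|split].
have H_measurable : H `<=` measurable.
  by move=> X [[s _ <-] _]; exact: measurable_corner.
have H_setI : setI_closed H.
  move=> X Y [[s _ <-] _] [[s' _ <-] _]; split => //; exists (s ++ s') => //.
  apply/seteqP; split => t; rewrite /corner/= all_cat; first by move=> /andP.
  by move=> [-> ->].
have cornerT : corner [::] = setT by apply/seteqP; split.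
apply: (@g_sigma_algebra_measure_unique_trace _ R (borelRn R n) (range corner) setT
  measurableT H_measurable H_setI mu nu) => //.
- by rewrite -cornerT eq_corner.
- by move=> X [[s _ <-] _]; exact: eq_corner.
- have := integrable_fin_num measurableT (mu_int (fun=> 0%N)).
  under eq_integral do rewrite /= /mon big1//.
  by rewrite integral_cst// mul1e ge0_fin_numE.
rewrite -/H HE.
have sub : @open 'rV[R]_n `<=` <<s range corner >>.
  move=> U /open_halfspaces; apply: smallest_sub; first exact: smallest_sigma_algebra.
  move=> _ [i [a ->]]; apply: sub_sigma_algebra; exists [:: (i, a)] => //.
  by apply/seteqP; split => t; rewrite /corner/= andbT.
by move: A mA; apply: smallest_sub => //; exact: smallest_sigma_algebra.
Qed.

End Uniqueness.

(** * Sequences as functionals on polynomials *)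

Local Open Scope complex_scope.

Section Functional.
Variables (K : comNzRingType) (N : nat) (d : multinom N -> K).

(** The body of [Lmap] over any ring, to be read over [R] as well as over [R[i]]. *)
Definition functional (p : mpoly N K) : K^o := \sum_(m <- msupp p) mcoeff m p * d m.

Lemma functional_seq (s : seq (multinom N)) p : uniq s -> {subset msupp p <= s} ->
  functional p = \sum_(m <- s) mcoeff m p * d m.
Proof.
move=> us ps; rewrite [RHS](bigID (mem (msupp p)))/= [X in _ + X]big1 ?addr0 => [|m mp].
  rewrite -big_filter; apply: perm_big; apply: uniq_perm.
  - exact: msupp_uniq.
  - exact: filter_uniq.
  - by move=> m; rewrite mem_filter; case: (boolP (m \in msupp p)) => // /ps ->.
by rewrite (memN_msupp_eq0 mp) mul0r.
Qed.

Lemma functional_is_linear : linear functional.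
Proof.
move=> c p q; pose s := undup (msupp (c *: p + q) ++ msupp p ++ msupp q).
have us : uniq s by exact: undup_uniq.
rewrite !(@functional_seq s)//.
- rewrite scaler_sumr -big_split/=; apply: eq_bigr => m _.
  by rewrite mcoeffD mcoeffZ mulrDl -mulrA.
- by move=> m mq; rewrite mem_undup !mem_cat mq !orbT.
- by move=> m mp; rewrite mem_undup !mem_cat mp !orbT.
- by move=> m mpq; rewrite mem_undup mem_cat mpq.
Qed.

HB.instance Definition _ := GRing.isLinear.Build K (mpoly N K) K^o _ functional
  functional_is_linear.

Lemma functionalX m : functional (mpolyX K m) = d m.
Proof.
rewrite (@functional_seq [:: m])//.
  by rewrite big_seq1 mcoeffX eqxx mul1r.
by move=> k; rewrite msuppX.
Qed.

End Functional.

Section MultiIndex.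
Variable n : nat.

Lemma mnm_ext_lift (alpha : multinom n) b i : mnm_ext alpha b (lift ord_max i) = alpha i.
Proof.
rewrite /mnm_ext /fun_of_multinom (tnth_nth 0%N) lift_max /= nth_rcons size_tuple ltn_ord.
by rewrite (tnth_nth 0%N).
Qed.

Lemma mnm_ext_max (alpha : multinom n) b : mnm_ext alpha b ord_max = b.
Proof.
by rewrite /mnm_ext /fun_of_multinom (tnth_nth 0%N) /= nth_rcons size_tuple ltnn eqxx.
Qed.

Lemma mnm_extP (m : multinom n.+1) : exists alpha b, m = mnm_ext alpha b.
Proof.
exists (Multinom [tuple m (lift ord_max i) | i < n]), (m ord_max).
apply/mnmP => j; case: (unliftP ord_max j) => [i ->|->].
  by rewrite mnm_ext_lift mnmE.
by rewrite mnm_ext_max.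
Qed.

Lemma prod_ext (K : comPzRingType) (F : 'I_n.+1 -> K) :
  \prod_j F j = (\prod_i F (lift ord_max i)) * F ord_max.
Proof.
rewrite big_ord_recr/=; congr (_ * _); apply: eq_bigr => i _.
by congr F; apply/val_inj; rewrite /= /bump leqNgt ltn_ord add0n.
Qed.

End MultiIndex.

Section ComplexPoly.
Variables (R : realType) (N : nat).

Let toC : mpoly N R -> mpoly N R[i] := map_mpoly (real_complex R).

Let toCE m p : mcoeff m (toC p) = (mcoeff m p)%:C.
Proof. exact: mcoeff_map_mpoly. Qed.

Lemma mpoly_complex_split (f : mpoly N R[i]) : exists g h : mpoly N R,
  f = toC g + 'i *: toC h.
Proof.
exists (\sum_(m <- msupp f) complex.Re (mcoeff m f) *: mpolyX R m),
       (\sum_(m <- msupp f) complex.Im (mcoeff m f) *: mpolyX R m).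
rewrite [LHS]mpolyE /toC [X in X + _]raddf_sum [X in _ *: X]raddf_sum scaler_sumr -big_split/=.
apply: eq_bigr => m _.
by rewrite !map_mpolyZ !map_mpolyX scalerA -scalerDl -complexE.
Qed.

Lemma conjc_add_i (a b : R) (x y : R[i]) : x = a%:C -> y = b%:C ->
  conjc (x + 'i * y) = x - 'i * y.
Proof.
move=> -> ->; apply/eqP; rewrite eq_complex /=.
by apply/andP; split; apply/eqP; ring.
Qed.

(** Reduces positivity over the complex numbers to positivity on squares of real polynomials. *)
Lemma mul_conj_poly (g h : mpoly N R) :
  (toC g + 'i *: toC h) * conj_poly (toC g + 'i *: toC h) = toC (g ^+ 2 + h ^+ 2).
Proof.
have -> : conj_poly (toC g + 'i *: toC h) = toC g - 'i *: toC h.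
  apply/mpolyP => m; rewrite /conj_poly mcoeff_map_mpoly mcoeffD mcoeffB !mcoeffZ.
  exact: conjc_add_i (toCE m g) (toCE m h).
have ii : 'i ^+ 2 = -1 :> R[i].
  by apply/eqP; rewrite eq_complex /=; apply/andP; split; apply/eqP; ring.
rewrite mulrC -subr_sqr exprZn ii scaleN1r opprK /toC rmorphD !rmorphXn.
by [].
Qed.

Lemma functional_toC (d : multinom N -> R) p :
  functional (fun m => (d m)%:C) (toC p) = (functional d p)%:C.
Proof.
rewrite (@functional_seq _ _ _ (msupp p)) ?msupp_uniq//.
  rewrite [RHS]rmorph_sum; apply: eq_bigr => m _.
  by rewrite mcoeff_map_mpoly rmorphM.
by move=> m; rewrite !mcoeff_msupp mcoeff_map_mpoly; apply: contraNneq => /= ->.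
Qed.

End ComplexPoly.

Section PositiveSemidefinite.
Variables (R : realType) (N : nat).

Lemma functional_shift (K : comNzRingType) (d : multinom N -> K) (e : multinom N) p :
  functional (fun m => d (mnm_add m e)) p = functional d (mpolyX K e * p).
Proof.
rewrite [X in _ = functional d (_ * X)]mpolyE mulr_sumr linear_sum.
apply: eq_bigr => m _.
by rewrite -scalerAr linearZ /= -mpolyXD functionalX addmC.
Qed.

Lemma functional_map_complex (d : multinom N -> R[i]) p :
  functional d (map_mpoly (real_complex R) p) =
  (functional (fun m => complex.Re (d m)) p +i* functional (fun m => complex.Im (d m)) p)%C.
Proof.
rewrite (@functional_seq _ _ _ (msupp p)) ?msupp_uniq//; last first.
  by move=> m; rewrite !mcoeff_msupp mcoeff_map_mpoly; apply: contraNneq => /= ->.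
rewrite /functional; elim: (msupp p) => [|m s IH]; first by rewrite !big_nil.
rewrite !big_cons IH mcoeff_map_mpoly; case: (d m) => a b /=.
by apply/eqP; rewrite eq_complex /=; apply/andP; split; apply/eqP; ring.
Qed.

Lemma pos_semidef_real (d : multinom N -> R) :
  (forall g : mpoly N R, 0 <= (functional d (g ^+ 2) : R)) -> pos_semidef (fun m => (d m)%:C).
Proof.
move=> dg f; have [g [h ->]] := mpoly_complex_split f.
rewrite mul_conj_poly -[Lmap _ _]/(functional _ _) functional_toC.
rewrite ler0c.
have -> : functional d (g ^+ 2 + h ^+ 2) = (functional d (g ^+ 2) : R) + functional d (h ^+ 2).
  by rewrite linearD.
exact: addr_ge0.
Qed.

(** The functional of the imaginary parts vanishes on real squares, and by polarization these span
    all polynomials. *)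
Lemma pos_semidefP (d : multinom N -> R[i]) : pos_semidef d ->
  (forall m, d m = (complex.Re (d m))%:C) /\
  (forall g : mpoly N R, 0 <= (functional (fun m => complex.Re (d m)) (g ^+ 2) : R)).
Proof.
move=> dpsd.
have key (g : mpoly N R) : 0 <= (functional (fun m => complex.Re (d m)) (g ^+ 2) : R) /\
    functional (fun m => complex.Im (d m)) (g ^+ 2) = 0.
  have := dpsd (map_mpoly (real_complex R) g + 'i *: map_mpoly (real_complex R) 0).
  rewrite mul_conj_poly expr0n addr0 -[Lmap _ _]/(functional _ _) functional_map_complex.
  by rewrite lecE /= => /andP[/eqP -> ->].
split => [m|g]; last by case: (key g).
have im p : functional (fun m => complex.Im (d m)) p = 0.
  have -> : p = 4^-1 *: ((p + 1) ^+ 2 - (p - 1) ^+ 2).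
    have -> : (p + 1) ^+ 2 - (p - 1) ^+ 2 = 4%:R *: p by rewrite scaler_nat -mulr_natl; ring.
    by rewrite scalerA mulVf ?scale1r// pnatr_eq0.
  by rewrite linearZ linearB /= !(key _).2 subr0 scaler0.
have := im (mpolyX R m); rewrite functionalX.
by case: (d m) => a b /= ->.
Qed.

End PositiveSemidefinite.

(** * From a representing measure to the extended sequence *)

Section MeasureToSequence.
Variables (R : realType) (n : nat) (mu : borel_measure R n).

Definition ext_monomial (a : 'I_n.+1 -> nat) (t : borelRn R n) : R :=
  \prod_j ext_coord j t ^+ a j.

Definition ext_moment (m : multinom n.+1) : R := Rintegral mu setT (ext_monomial m).

Lemma ext_monomial_mnm_ext (alpha : multinom n) b t :
  ext_monomial (mnm_ext alpha b) t = monomial_fun alpha t * (1 + \sum_i t 0 i ^+ 2)^-1 ^+ b.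
Proof.
rewrite /ext_monomial prod_ext ext_coord_max mnm_ext_max; congr (_ * _).
by apply: eq_bigr => i _; rewrite ext_coord_lift mnm_ext_lift.
Qed.

Lemma ext_monomial_split (alpha : multinom n) b t :
  ext_monomial (mnm_ext alpha b) t = ext_monomial (mnm_ext alpha b.+1) t +
    \sum_(j < n) ext_monomial (mnm_ext (mnm_add alpha (mnm_muln (mnm1 j) 2)) b.+1) t.
Proof.
under eq_bigr => j _.
  rewrite ext_monomial_mnm_ext.
  have -> : monomial_fun (mnm_add alpha (mnm_muln (mnm1 j) 2)) t =
      monomial_fun alpha t * t 0 j ^+ 2 :> R.
    rewrite /monomial_fun; under eq_bigr do rewrite mnmDE exprD.
    rewrite big_split/=; congr (_ * _); rewrite (bigD1 j)//= big1 ?mulr1.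
      by rewrite mulmnE mnm1E eqxx mul1n.
    by move=> i ij; rewrite mulmnE mnm1E eq_sym (negPf ij).
  over.
rewrite !ext_monomial_mnm_ext -mulr_suml -mulr_sumr.
set s := \sum_(_ < _) _; set e := _ ^-1.
have es : e * (1 + s) = 1 by rewrite mulVf// gt_eqF// one_add_sqr_gt0.
rewrite exprS; transitivity (monomial_fun alpha t * e ^+ b * (e * (1 + s))); last by ring.
by rewrite es mulr1.
Qed.

Lemma normc_real (x : R) : Normc.normc x%:C = `|x|.
Proof. by rewrite /Normc.normc /= expr0n addr0 sqrtr_sqr. Qed.

Lemma poly_funX (alpha : multinom n) t :
  poly_fun (mpolyX R[i] alpha) t = (monomial_fun alpha t)%:C.
Proof.
rewrite /poly_fun mevalX /monomial_fun rmorph_prod; apply: eq_bigr => i _.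
by rewrite rmorphXn.
Qed.

Lemma measurable_monomial_fun (alpha : multinom n) :
  measurable_fun setT (monomial_fun alpha : borelRn R n -> R).
Proof.
by apply: measurable_prod => j _; apply: measurable_funX; exact: measurable_fun_coord.
Qed.

(** The added coordinate is at most 1, and [|u| <= 1 + u ^ 2] bounds the remaining monomial by two
    squares that are integrable by hypothesis. *)
Lemma L2_ext_integrable : (forall f : mpoly n R[i], in_L2 mu (poly_fun f)) ->
  forall a, mu.-integrable setT (EFin \o ext_monomial a).
Proof.
move=> muL2 a.
have iX (alpha : multinom n) : mu.-integrable setT (EFin \o (fun t => monomial_fun alpha t ^+ 2)).
  have [_ _ hlt] := muL2 (mpolyX R[i] alpha).
  apply/integrableP; split.
    by apply/measurable_EFinP; apply: measurable_funX; exact: measurable_monomial_fun.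
  move: hlt; congr (_ < _)%E; apply: eq_integral => t _.
  by rewrite poly_funX normc_real /= normrX real_normK ?num_real// ger0_norm ?sqr_ge0.
pose alpha : multinom n := Multinom [tuple a (lift ord_max i) | i < n].
have i2 := integrableD measurableT (iX mnm0) (iX alpha).
apply: (le_integrable measurableT _ _ i2).
  by apply/measurable_EFinP; exact: measurable_ext_monomial.
move=> t _; rewrite /= lee_fin.
have -> : monomial_fun mnm0 t = 1 :> R.
  by rewrite /monomial_fun big1// => i _; rewrite mnm0E expr0.
have -> : ext_monomial a t = monomial_fun alpha t * ext_coord ord_max t ^+ a ord_max.
  rewrite /ext_monomial prod_ext; congr (_ * _); apply: eq_bigr => i _.
  by rewrite ext_coord_lift mnmE.
have e0 := ext_coord_max_gt0 t; have e1 := ext_coord_max_le1 t.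
set u := monomial_fun _ _.
rewrite normrM expr1n [leRHS]ger0_norm ?addr_ge0 ?sqr_ge0//.
apply: (@le_trans _ _ `|u|).
  by rewrite ler_piMr// ger0_norm ?exprn_ge0 ?exprn_ile1// ltW.
have := sqr_ge0 (`|u| - 2^-1); have := real_normK (num_real u); nra.
Qed.

Hypothesis mu_int : forall a, mu.-integrable setT (EFin \o ext_monomial a).

Lemma ext_poly_integral (p : mpoly n.+1 R) :
  mu.-integrable setT (EFin \o (fun t => meval (fun j => ext_coord j t) p)) /\
  Rintegral mu setT (fun t => meval (fun j => ext_coord j t) p) = functional ext_moment p.
Proof.
have iF (m : multinom n.+1) : mu.-integrable setT
    (EFin \o (fun t => mcoeff m p * ext_monomial m t)).
  exact: (integrableZl measurableT (mcoeff m p) (mu_int m)).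
have [iS IS] := @Rintegral_sum _ _ _ mu setT _ (msupp p) _ measurableT iF.
have e : (fun t : borelRn R n => meval (fun j => ext_coord j t) p) =
    (fun t => \sum_(m <- msupp p) mcoeff m p * ext_monomial m t).
  by apply/funext => t; rewrite mevalE.
rewrite e; split => //; rewrite IS; apply: eq_bigr => m _.
by rewrite RintegralZl//; exact: mu_int.
Qed.

(** Every point outside the support has a null open neighbourhood, so [open_cover_null] applies. *)
Lemma support_orthant_null i : measure_support mu `<=` @orthant R n ->
  mu [set t | t 0 i < 0] = 0.
Proof.
move=> supp; apply: measure_negligible.
  have := @measurable_fun_coord R n i measurableT _ (measurable_itv `]-oo, 0[).
  rewrite setTI; congr (measurable _).
apply: open_cover_null => t /= ti.
have : ~ measure_support mu t by move=> /supp/(_ i); rewrite leNgt ti.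
move=> /existsNP[U /not_implyP[oU /not_implyP[Ut /negP]]].
rewrite -leNgt => U0; exists U; split => //.
by apply/eqP; rewrite eq_le measure_ge0 andbT.
Qed.

Lemma dim_extension_of_measure (gamma : multiindex n -> R[i]) :
  representing_measure_orthant gamma mu -> dim_extension gamma (fun m => (ext_moment m)%:C).
Proof.
move=> [[_ gammaE] supp]; split.
- apply: pos_semidef_real => g; have [_ <-] := ext_poly_integral (g ^+ 2).
  by apply: Rintegral_ge0 => t _; rewrite rmorphXn sqr_ge0.
- move=> alpha; rewrite gammaE; congr (_%:C); apply: eq_Rintegral => t _.
  by rewrite -[RHS]/(ext_monomial (mnm_ext alpha 0) t) ext_monomial_mnm_ext expr0 mulr1.
- move=> alpha b; rewrite -rmorph_sum -rmorphD; congr (_%:C).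
  have [iS IS] := @Rintegral_sum _ _ _ mu setT _ (index_enum 'I_n) _ measurableT
    (fun j => mu_int (mnm_ext (mnm_add alpha (mnm_muln (mnm1 j) 2)) b.+1)).
  rewrite /ext_moment -IS -RintegralD//; last exact: mu_int.
  apply: eq_Rintegral => t _.
  exact: ext_monomial_split.
- move=> j; apply: pos_semidef_real => g.
  rewrite functional_shift; have [iP <-] := ext_poly_integral (mpolyX R (mnm_ext (mnm1 j) 0) * g ^+ 2).
  have mD : measurable [set t : borelRn R n | 0 <= (t : 'rV[R]_n) 0 j].
    have -> : [set t : borelRn R n | 0 <= (t : 'rV[R]_n) 0 j] =
        setT `&` (fun t : borelRn R n => (t : 'rV[R]_n) 0 j) @^-1` `[0, +oo[.
      by rewrite setTI; apply/seteqP; split => t; rewrite /= in_itv/= andbT.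
    exact: measurable_fun_coord.
  have D0 : mu (~` [set t : borelRn R n | 0 <= (t : 'rV[R]_n) 0 j]) = 0.
    rewrite -[RHS](support_orthant_null j supp); congr (mu _).
    by apply/seteqP; split => t /=; rewrite ltNge => /negP.
  rewrite /Rintegral (negligible_integral (measurableC mD) _ iP D0)// setTD setCK.
  apply: fine_ge0; apply: integral_ge0 => t /= tj.
  rewrite lee_fin rmorphM rmorphXn /= mulr_ge0 ?sqr_ge0// mevalX.
  rewrite -[leRHS]/(ext_monomial (mnm_ext (mnm1 j) 0) t) ext_monomial_mnm_ext expr0 mulr1.
  rewrite /monomial_fun (bigD1 j)//= mnm1E eqxx expr1 big1 ?mulr1// => i.
  by rewrite mnm1E eq_sym => /negPf ->.
Qed.

End MeasureToSequence.

(** * From the extended sequence to a representing measure *)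

Section SequenceToMeasure.
Variables (R : realType) (n : nat).

Lemma mnm_ext_mnm1 (i : 'I_n) : mnm_ext (mnm1 i) 0 = mnm1 (lift ord_max i).
Proof.
apply/mnmP => j; rewrite mnm1E; case: (unliftP ord_max j) => [k ->|->].
  by rewrite mnm_ext_lift mnm1E (inj_eq lift_inj).
by rewrite mnm_ext_max eq_sym eq_liftF.
Qed.

Lemma mnm_add_max (alpha : multinom n) b :
  mnm_add (mnm1 ord_max) (mnm_ext alpha b) = mnm_ext alpha b.+1.
Proof.
apply/mnmP => j; rewrite mnmDE mnm1E; case: (unliftP ord_max j) => [k ->|->].
  by rewrite !mnm_ext_lift eq_liftF.
by rewrite !mnm_ext_max eqxx.
Qed.

Lemma mnm_add_lift (alpha : multinom n) b i :
  mnm_add (mnm_muln (mnm1 (lift ord_max i)) 2) (mnm_ext alpha b) =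
  mnm_ext (mnm_add alpha (mnm_muln (mnm1 i) 2)) b.
Proof.
apply/mnmP => j; rewrite mnmDE mulmnE mnm1E; case: (unliftP ord_max j) => [k ->|->].
  by rewrite !mnm_ext_lift mnmDE mulmnE mnm1E (inj_eq lift_inj) addnC.
by rewrite !mnm_ext_max [_ == ord_max]eq_sym eq_liftF.
Qed.

Lemma add_i_complex (a b : R) (x y : R[i]) : x = a%:C -> y = b%:C ->
  x + 'i * y = (a +i* b)%C.
Proof.
move=> -> ->; apply/eqP; rewrite eq_complex /=.
by apply/andP; split; apply/eqP; ring.
Qed.

Lemma poly_fun_split (g h : mpoly n R) t :
  poly_fun (map_mpoly (real_complex R) g + 'i *: map_mpoly (real_complex R) h) t =
  (meval (fun i => t 0 i) g +i* meval (fun i => t 0 i) h)%C.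
Proof.
have ev (p : mpoly n R) : meval (fun i => (t 0 i)%:C) (map_mpoly (real_complex R) p) =
    (meval (fun i => t 0 i) p)%:C.
  rewrite [in RHS]mevalE -[(\sum_(m <- _) _)%:C]functional_toC mevalE.
  by apply: eq_bigr => m _; rewrite rmorph_prod; congr (_ * _); apply: eq_bigr => i _; rewrite rmorphXn.
rewrite /poly_fun mevalD mevalZ; exact: add_i_complex (ev g) (ev h).
Qed.

Lemma in_L2_of_ext_integrable (mu : borel_measure R n) :
  (forall a, mu.-integrable setT (EFin \o @ext_monomial R n a)) ->
  forall f : mpoly n R[i], in_L2 mu (poly_fun f).
Proof.
move=> mu_int f; have [g [h ->]] := mpoly_complex_split f.
have int_poly (p : mpoly n R) :
    mu.-integrable setT (EFin \o (fun t : borelRn R n => meval (fun i => (t : 'rV[R]_n) 0 i) p)).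
  have iF (m : multinom n) : mu.-integrable setT
      (EFin \o (fun t => mcoeff m p * ext_monomial (mnm_ext m 0) t)).
    exact: (integrableZl measurableT (mcoeff m p) (mu_int (mnm_ext m 0))).
  have [iS _] := @Rintegral_sum _ _ _ mu setT _ (msupp p) _ measurableT iF.
  apply: eq_integrable iS => // t _ /=; rewrite mevalE; congr (_%:E).
  by apply: eq_bigr => m _; rewrite ext_monomial_mnm_ext expr0 mulr1.
have meas (p : mpoly n R) : measurable_fun setT
    (fun t : borelRn R n => meval (fun i => (t : 'rV[R]_n) 0 i) p).
  by apply/measurable_EFinP; exact: measurable_int (int_poly p).
split.
- by under eq_fun do rewrite poly_fun_split; exact: meas.
- by under eq_fun do rewrite poly_fun_split; exact: meas.
have /integrableP[_] := int_poly (g ^+ 2 + h ^+ 2); congr (_ < _)%E.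
apply: eq_integral => t _; rewrite poly_fun_split /Normc.normc /= mevalD !rmorphXn.
by rewrite sqr_sqrtr ?ger0_norm// addr_ge0 ?sqr_ge0.
Qed.

Lemma measure_of_dim_extension (gamma : multiindex n -> R[i])
    (delta : multiindex n.+1 -> R[i]) : dim_extension gamma delta ->
  exists mu : borel_measure R n, representing_measure_orthant gamma mu /\
    forall m, delta m = (ext_moment mu m)%:C.
Proof.
move=> [psd d0 drec dshift].
have [dreal dsqr] := pos_semidefP psd.
pose d m := complex.Re (delta m).
pose l : {linear mpoly n.+1 R -> R^o} := functional d.
pose x (i : 'I_n) := mpolyX R (mnm1 (lift ord_max i)).
pose y := mpolyX R (mnm1 (@ord_max n)).
(* On monomials this is the recursion [drec], read from right to left. *)
have l_yh p : l (y * (1 + \sum_j x j ^+ 2) * p) = l p.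
  rewrite [p]mpolyE mulr_sumr !linear_sum; apply: eq_bigr => m _.
  rewrite -scalerAr !linearZ /=; congr (_ *: _).
  have [alpha [b ->]] := mnm_extP m.
  rewrite mulrAC /y -mpolyXD mnm_add_max mulrDr mulr1 mulr_sumr linearD linear_sum /=.
  rewrite !functionalX /d [in RHS]drec [RHS]raddfD raddf_sum /=; congr (_ + _).
  apply: eq_bigr => j _.
  by rewrite mulrC /x mpolyXn -mpolyXD mnm_add_lift functionalX.
have l_xsqr j p : 0 <= l (x j * p ^+ 2).
  have [_ /(_ p)] := pos_semidefP (dshift j).
  by rewrite /x -mnm_ext_mnm1 /l /= -functional_shift.
have [dS [S [P [T [G [[mG G0] mT T0 TI]]]]]] := orthant_representation l_yh dsqr l_xsqr.
have mrow := measurable_fun_rV mT.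
pose phi : S -> borelRn R n := fun s => \row_i T i s.
pose mu_of := (pushforward P phi : borel_measure R n).
pose mu := mu_of mrow.
have monE a s : ext_monomial a (phi s) =
    \prod_i T i s ^+ a (lift ord_max i) * (1 + \sum_i T i s ^+ 2)^-1 ^+ a ord_max.
  rewrite /ext_monomial prod_ext ext_coord_max; congr (_ * _ ^-1 ^+ _).
    by apply: eq_bigr => i _; rewrite ext_coord_lift mxE.
  by congr (_ + _); apply: eq_bigr => i _; rewrite mxE.
have xyE (m : multinom n.+1) : mpolyX R m =
    \prod_i x i ^+ m (lift ord_max i) * y ^+ m ord_max.
  by rewrite mpolyXE_id prod_ext.
have muE (m : multinom n.+1) : mu.-integrable setT (EFin \o @ext_monomial R n m) /\ ext_moment mu m = d m.
  have [iP IP] := TI (fun i => m (lift ord_max i)) (m ord_max).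
  have iphi : P.-integrable (phi @^-1` setT) ((EFin \o @ext_monomial R n m) \o phi).
    rewrite preimage_setT; apply: eq_integrable iP => // s _ /=.
    by rewrite monE.
  have mm : measurable_fun setT (EFin \o @ext_monomial R n m).
    by apply/measurable_EFinP; exact: measurable_ext_monomial.
  split; first exact: (integrable_pushforward mrow mm iphi measurableT).
  rewrite /ext_moment /Rintegral [X in fine X](integral_pushforward mrow mm iphi measurableT).
  rewrite -[RHS](functionalX d) xyE -IP /Rintegral preimage_setT; congr fine.
  by apply: eq_integral => s _ /=; rewrite monE.
exists mu; split; last by move=> m; rewrite (muE m).2 -dreal.
have mu_int a : mu.-integrable setT (EFin \o @ext_monomial R n a).
  have := (muE (Multinom [tuple a i | i < n.+1])).1.
  by congr (_.-integrable _ (EFin \o _)); apply/funext => t; apply: eq_bigr => j _; rewrite mnmE.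
split; first split.
- exact: in_L2_of_ext_integrable.
- move=> alpha; rewrite d0 dreal -[complex.Re _]/(d _) -(muE _).2; congr (_%:C).
  by apply: eq_Rintegral => t _; rewrite -[LHS]/(ext_monomial (mnm_ext alpha 0) t)
    ext_monomial_mnm_ext expr0 mulr1.
(* A support point with a negative coordinate would give the open half-space [U] positive mass, but
   the preimage of [U] avoids the conull set [G]. *)
move=> t supp i; rewrite leNgt; apply/negP => ti.
pose U := [set u : 'rV[R]_n | u 0 i < 0].
have oU : open U.
  have -> : U = (fun u : 'rV[R]_n => u 0 i) @^-1` [set r | r < 0] by [].
  by apply: open_comp; [move=> u _; exact: coord_continuous|exact: open_lt].
have := supp U oU ti; rewrite lt_neqAle eq_sym => /andP[/negP + _]; apply.
rewrite eq_le measure_ge0 andbT -G0 /mu/mu_of/= /pushforward; apply: le_measure; rewrite ?inE.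
- rewrite -[X in measurable X]setTI; by apply: (mrow measurableT); exact: sub_sigma_algebra.
- exact: measurableC.
- by move=> s; rewrite /U/= mxE => Ti Gs; move: Ti; rewrite ltNge T0.
Qed.

End SequenceToMeasure.

Theorem theorem2p9 (R : realType) (n : nat) (n_ge1 : (1 <= n)%N)
    (gamma : multiindex n -> complex R)
    (gamma0_gt0 : 0 < gamma mnm0) :
  (moment_sequence gamma /\
     (exists mu : borel_measure R n, representing_measure_orthant gamma mu)
   <->
   exists delta : multiindex n.+1 -> complex R, dim_extension gamma delta)
  /\
  ((exists mu : borel_measure R n,
      representing_measure_orthant gamma mu /\
      forall nu : borel_measure R n, representing_measure_orthant gamma nu ->
        forall A : set (borelRn R n), measurable A -> mu A = nu A)
   <->
   exists delta : multiindex n.+1 -> complex R,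
      dim_extension gamma delta /\
      forall delta' : multiindex n.+1 -> complex R,
        dim_extension gamma delta' -> forall m, delta m = delta' m).
Proof.
have int_of_rep (mu : borel_measure R n) : representing_measure_orthant gamma mu ->
    forall a, mu.-integrable setT (EFin \o @ext_monomial R n a).
  by move=> [[muL2 _] _]; exact: L2_ext_integrable.
have ext_of_rep (mu : borel_measure R n) : representing_measure_orthant gamma mu ->
    dim_extension gamma (fun m => (ext_moment mu m)%:C).
  by move=> rmu; apply: dim_extension_of_measure => //; exact: int_of_rep.
split; split.
- by move=> [_ [mu rmu]]; exists (fun m => (ext_moment mu m)%:C); exact: ext_of_rep.
- move=> [delta ext]; have [mu [rmu _]] := measure_of_dim_extension ext.
  by split; exists mu => //; case: rmu.
(* Any [delta'] consists of the extended moments of some representing measure, which is [mu] by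
   uniqueness. *)
- move=> [mu [rmu mu_unique]]; exists (fun m => (ext_moment mu m)%:C).
  split; first exact: ext_of_rep.
  move=> delta' ext' m; have [nu [rnu ->]] := measure_of_dim_extension ext'.
  congr (fine _)%:C; apply: eq_measure_integral => A mA _; exact: mu_unique.
(* Any other representing measure yields an extension, hence [delta]; so its extended moments are
   those of [mu], and they determine it. *)
- move=> [delta [ext delta_unique]]; have [mu [rmu muE]] := measure_of_dim_extension ext.
  exists mu; split => // nu rnu A mA.
  apply: (borel_measure_unique (int_of_rep _ rmu) (int_of_rep _ rnu)) => // a.
  have := delta_unique _ (ext_of_rep _ rnu) (Multinom [tuple a i | i < n.+1]).
  rewrite muE => /complexI; rewrite /ext_moment.
  have -> // : fun_of_multinom (Multinom [tuple a i | i < n.+1]) = a.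
  by apply/funext => j; rewrite mnmE.
Qed.
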